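(* For $s=1,\dots,n$, we have $$\widetilde H_s\,\omega_D=h_s\,\omega_D$$ in $M_{\boldsymbol\Lambda}\otimes A_D$. Moreover, we have $$\omega_D\in\mathrm{Sing}\,M_{\boldsymbol\Lambda}[\Lambda^{(\infty)}]\otimes A_D .$$
   Context: $\mathfrak{gl}_2$ is the Lie algebra of complex $2\times2$ matrices with standard generators $e_{ab}$, $a,b=1,2$; $\epsilon_1,\epsilon_2$ is the standard basis of the dual of the diagonal Cartan subalgebra and $\alpha=\epsilon_1-\epsilon_2$. Fix distinct $z_1,\dots,z_n\in\mathbb C$, numbers $m_1,\dots,m_n\in\mathbb C$ and an integer $l\ge 0$. Put $\Lambda^{(s)}=m_s\epsilon_1$, $\boldsymbol\Lambda=(\Lambda^{(1)},\dots,\Lambda^{(n)})$, $\Lambda^{(\infty)}=\sum_{s=1}^n\Lambda^{(s)}-l\alpha$. $M_{\boldsymbol\Lambda}=M_{\Lambda^{(1)}}\otimes\cdots\otimes M_{\Lambda^{(n)}}$ is the tensor product of Verma $\mathfrak{gl}_2$-modules; $M_{\Lambda^{(s)}}$ has generating vector $v_{\Lambda^{(s)}}$ with $e_{12}v_{\Lambda^{(s)}}=0$, $e_{11}v_{\Lambda^{(s)}}=m_sv_{\Lambda^{(s)}}$, $e_{22}v_{\Lambda^{(s)}}=0$ and basis $e_{21}^jv_{\Lambda^{(s)}}$, $j\ge0$. $\mathrm{Sing}\,M_{\boldsymbol\Lambda}[\Lambda^{(\infty)}]=\{v\in M_{\boldsymbol\Lambda}: e_{12}v=0,\ e_{22}v=lv\}$.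 The Gaudin Hamiltonians are $\widetilde H_s=\sum_{r\ne s}\frac{1}{z_s-z_r}(m_sm_r-\Omega_{s,r})\in\mathrm{End}(M_{\boldsymbol\Lambda})$, where $\Omega_{s,r}=\sum_{i,j=1}^2e_{ij}^{(s)}e_{ji}^{(r)}$ and $e_{ij}^{(s)}$ acts in the $s$-th tensor factor. Algebra $A_D$. Let $\boldsymbol a=(a_1,\dots,a_l)$, $\boldsymbol h=(h_1,\dots,h_n)$ be variables, $p(x,\boldsymbol a)=x^l+a_1x^{l-1}+\dots+a_l$, $$\mathcal D_{\boldsymbol h}=\Big(\prod_{s=1}^n(x-z_s)\Big)\Big(\frac{d^2}{dx^2}-\sum_{s=1}^n\frac{m_s}{x-z_s}\frac d{dx}+\sum_{s=1}^n\frac{h_s}{x-z_s}\Big),$$ $q_{-1}(\boldsymbol h)=\sum_s h_s$, $q_0(\boldsymbol h)=\sum_s z_sh_s-l(\sum_s m_s+1-l)$. For $1\le i\le l+n-2$ let $q_i(\boldsymbol a,\boldsymbol h)$ be the coefficient of $x^{l+n-2-i}$ in $\mathcal D_{\boldsymbol h}(p(x,\boldsymbol a))$ (when $q_{-1}=q_0=0$ these are all its coefficients). $I_D\subset\mathbb C[\boldsymbol a,\boldsymbol h]$ is the ideal generated by $q_{-1},q_0,q_1,\dots,q_{l+n-2}$ and $A_D=\mathbb C[\boldsymbol a,\boldsymbol h]/I_D$. Universal weight function. Identify $M_{\boldsymbol\Lambda}$ with $\mathbb C[x^{(1)},\dots,x^{(n)}]$ via $e_{21}^{j_1}v_{\Lambda^{(1)}}\otimes\cdots\otimes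 e_{21}^{j_n}v_{\Lambda^{(n)}}\mapsto (x^{(1)})^{j_1}\cdots(x^{(n)})^{j_n}$. The universal weight function is $$\omega=\prod_{j=1}^l\Big(\prod_{i=1}^n(t_j-z_i)\sum_{s=1}^n\frac{x^{(s)}}{t_j-z_s}\Big);$$ being a symmetric polynomial in $t_1,\dots,t_l$, it is viewed as a polynomial in $x^{(1)},\dots,x^{(n)}$ and $\boldsymbol a$ through $\prod_{i=1}^l(x-t_i)=p(x,\boldsymbol a)$, i.e. as an element of $M_{\boldsymbol\Lambda}\otimes\mathbb C[\boldsymbol a]$. $\omega_D$ is its projection to $M_{\boldsymbol\Lambda}\otimes A_D$. On $M_{\boldsymbol\Lambda}\otimes A_D$, $\widetilde H_s$ acts on the first factor and $h_s$ acts by multiplication on the second. *)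

(* Defs.v *)
From HB Require Import structures.
From mathcomp Require Import all_boot all_order all_algebra.
From mathcomp Require Import perm generic_quotient ring_quotient.
From mathcomp Require Import ring.
From mathcomp Require Export complex reals.
From mathcomp Require Import boolp ssrcomplements mpoly.
From mathcomp Require finmap monalg.
(* Selective imports: the notations of finmap and monalg clash with mpoly. *)
Import (canonicals, coercions) finmap.
Import (canonicals, coercions) monalg.

Set Implicit Arguments.
Unset Strict Implicit.
Unset Printing Implicit Defensive.

Import GRing.Theory.
Local Open Scope ring_scope.

Section IdealQuotient.
Context (K : comNzRingType) (P : comAlgType K) (S : seq P).

Definition gen_ideal : pred P :=
  fun p => `[< exists c : 'I_(size S) -> P, p = \sum_i c i * S`_i >].

Lemma gen_idealP (p : P) :
  reflect (exists c : 'I_(size S) -> P, p = \sum_i c i * S`_i) (p \in gen_ideal).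
Proof. exact: asboolP. Qed.

Fact gen_ideal_zmod_closed : zmod_closed gen_ideal.
Proof.
split=> [|p q /gen_idealP[c ->] /gen_idealP[d ->]]; apply/gen_idealP.
  by exists (fun=> 0); rewrite big1 // => i _; rewrite mul0r.
exists (fun i => c i - d i); rewrite -sumrB.
by apply: eq_bigr => i _; rewrite mulrBl.
Qed.

HB.instance Definition _ := GRing.isZmodClosed.Build P gen_ideal
  gen_ideal_zmod_closed.

Lemma gen_ideal_mull (a p : P) : p \in gen_ideal -> a * p \in gen_ideal.
Proof.
move=> /gen_idealP[c ->]; apply/gen_idealP; exists (fun i => a * c i).
by rewrite mulr_sumr; apply: eq_bigr => i _; rewrite mulrA.
Qed.

(* [{ideal_quot I}] of ring_quotient is a ring only when [1 \notin I]; the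
   ideal may be the unit ideal here, so the ring structure is put on the
   additive quotient, as a possibly trivial ring. *)
Definition gen_ideal_closed : zmodClosed P := GRing.ZmodClosed.clone P gen_ideal _.
Definition gen_quot := Quotient.quot gen_ideal_closed.

HB.instance Definition _ := GRing.Zmodule.on gen_quot.

Definition gen_pi (p : P) : gen_quot := \pi_(Quotient.quot gen_ideal_closed)%qT p.

Lemma gen_pi_eq (p q : P) : (gen_pi p = gen_pi q) <-> (p - q \in gen_ideal).
Proof. by rewrite Quotient.idealrBE; split=> [/eqP|/eqP]. Qed.

Fact gen_pi_additive : zmod_morphism gen_pi.
Proof. by move=> p q; rewrite /gen_pi !piE. Qed.

HB.instance Definition _ := GRing.isZmodMorphism.Build P gen_quot gen_pi
  gen_pi_additive.

Lemma gen_pi_surj (x : gen_quot) : exists p, x = gen_pi p.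
Proof. by exists (repr x); rewrite /gen_pi reprK. Qed.

Definition gq_one : gen_quot := gen_pi 1.
Definition gq_mul (x y : gen_quot) : gen_quot := gen_pi (repr x * repr y).
Definition gq_scale (c : K) (x : gen_quot) : gen_quot := gen_pi (c *: repr x).

Lemma gen_repr_pi (p : P) : repr (gen_pi p) - p \in gen_ideal.
Proof. by apply/gen_pi_eq; rewrite /gen_pi reprK. Qed.

Lemma gq_mul_pi (p q : P) : gq_mul (gen_pi p) (gen_pi q) = gen_pi (p * q).
Proof.
apply/gen_pi_eq.
set p' := repr _; set q' := repr _.
have -> : p' * q' - p * q = q' * (p' - p) + p * (q' - q) by ring.
by rewrite rpredD ?gen_ideal_mull // gen_repr_pi.
Qed.

Lemma gq_scale_pi (c : K) (p : P) : gq_scale c (gen_pi p) = gen_pi (c *: p).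
Proof.
apply/gen_pi_eq; rewrite -scalerBr -[X in c *: X]mul1r scalerAl.
by rewrite gen_ideal_mull // gen_repr_pi.
Qed.

Fact gq_mulA : associative gq_mul.
Proof.
move=> x y w; have [p ->] := gen_pi_surj x; have [q ->] := gen_pi_surj y.
by have [r ->] := gen_pi_surj w; rewrite !gq_mul_pi mulrA.
Qed.

Fact gq_mulC : commutative gq_mul.
Proof. by move=> x y; rewrite /gq_mul mulrC. Qed.

Fact gq_mul1 : left_id gq_one gq_mul.
Proof. by move=> x; have [p ->] := gen_pi_surj x; rewrite gq_mul_pi mul1r. Qed.

Fact gq_mulD : left_distributive gq_mul +%R.
Proof.
move=> x y w; have [p ->] := gen_pi_surj x; have [q ->] := gen_pi_surj y.
by have [r ->] := gen_pi_surj w; rewrite -raddfD !gq_mul_pi mulrDl raddfD.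
Qed.

HB.instance Definition _ := GRing.Zmodule_isComPzRing.Build gen_quot
  gq_mulA gq_mulC gq_mul1 gq_mulD.

Fact gq_scaleA (c d : K) (x : gen_quot) :
  gq_scale c (gq_scale d x) = gq_scale (c * d) x.
Proof. by have [p ->] := gen_pi_surj x; rewrite !gq_scale_pi scalerA. Qed.

Fact gq_scale1 : left_id 1 gq_scale.
Proof. by move=> x; have [p ->] := gen_pi_surj x; rewrite gq_scale_pi scale1r. Qed.

Fact gq_scaleDr : right_distributive gq_scale +%R.
Proof.
move=> c x y; have [p ->] := gen_pi_surj x; have [q ->] := gen_pi_surj y.
by rewrite -raddfD !gq_scale_pi scalerDr raddfD.
Qed.

Fact gq_scaleDl (x : gen_quot) : {morph gq_scale^~ x : c d / c + d}.
Proof.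
by move=> c d; have [p ->] := gen_pi_surj x; rewrite !gq_scale_pi scalerDl raddfD.
Qed.

HB.instance Definition _ := GRing.Zmodule_isLmodule.Build K gen_quot
  gq_scaleA gq_scale1 gq_scaleDr gq_scaleDl.

Lemma gen_piM (p q : P) : gen_pi (p * q) = gen_pi p * gen_pi q.
Proof. by rewrite -gq_mul_pi. Qed.

Lemma gen_pi1 : gen_pi 1 = 1.
Proof. by []. Qed.

Lemma gen_piZ (c : K) (p : P) : gen_pi (c *: p) = c *: gen_pi p.
Proof. by rewrite -gq_scale_pi. Qed.

End IdealQuotient.

Section Verma.
Context {K : fieldType}.
Implicit Types (m : K) (f g : {poly K}).

(* The Verma module M_{m eps_1} is carried by {poly K}, with 'X^j standing for
   e_21^j v, and [verma_e m a b] is the action of e_{ab}; the indices [0] and [1]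
   of ['I_2] are the matrix indices 1 and 2. On this basis,
     e_11 'X^j = (m - j) 'X^j,  e_12 'X^j = j (m - j + 1) 'X^(j-1),
     e_21 'X^j = 'X^(j+1),      e_22 'X^j = j 'X^j. *)
Definition verma_e (m : K) (a b : 'I_2) (f : {poly K}) : {poly K} :=
  if a == 0 then
    if b == 0 then m *: f - 'X * f^`() else m *: f^`() - 'X * f^`()^`()
  else if b == 0 then 'X * f else 'X * f^`().

Lemma verma_e_linear m a b : linear (verma_e m a b).
Proof.
move=> c f g; rewrite /verma_e; do 2!case: ifP => _;
  rewrite ?derivD ?derivZ ?derivD ?derivZ -!mul_polyC; ring.
Qed.

HB.instance Definition _ m a b := GRing.isLinear.Build K {poly K} {poly K} _
  (verma_e m a b) (verma_e_linear m a b).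

Lemma verma_gl2 m (a b c d : 'I_2) f :
  verma_e m a b (verma_e m c d f) - verma_e m c d (verma_e m a b f)
  = (b == c)%:R *: verma_e m a d f - (d == a)%:R *: verma_e m c b f.
Proof.
have I2 (P : 'I_2 -> Prop) : P 0 -> P 1 -> forall i, P i.
  move=> P0 P1 [[|[|//]] lti].
    by rewrite (_ : Ordinal lti = 0) //; apply: val_inj.
  by rewrite (_ : Ordinal lti = 1) //; apply: val_inj.
elim/I2: a; elim/I2: b; elim/I2: c; elim/I2: d; rewrite /verma_e /= ?eqxx /=;
  rewrite -!mul_polyC ?mul0r ?mul1r; rewrite ?(derivE, derivB, derivD, derivM) /=;
  rewrite ?(derivE, derivB, derivD, derivM) /= ; ring.
Qed.

Lemma verma_highest_weight m :
  [/\ verma_e m 0 1 1 = 0, verma_e m 0 0 1 = m *: 1 & verma_e m 1 1 1 = 0].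
Proof.
by rewrite /verma_e /= !derivE !mulr0 ?scaler0 ?subr0 ?derivE ?mulr0 ?subr0.
Qed.

Lemma verma_basis m j : iter j (verma_e m 1 0) 1 = 'X^j.
Proof. by elim: j => //= j ->; rewrite /verma_e /= exprS. Qed.

End Verma.

Section TensorVerma.
Context {K : fieldType} {n : nat}.
Implicit Types (s r : 'I_n) (k : 'X_{1..n}) (v : {mpoly K[n]}).

(* The tensor product of n Verma modules is carried by {mpoly K[n]}, with 'X_[k]
   standing for e_21^(k 0) v (x) ... (x) e_21^(k (n-1)) v. *)
Definition mnm_set k s (j : nat) : 'X_{1..n} :=
  [multinom (if i == s then j else k i) | i < n].

(* The operator 1 (x) ... (x) E (x) ... (x) 1 with E in the s-th factor. *)
Definition factor_act s (E : {poly K} -> {poly K}) v : {mpoly K[n]} :=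
  \sum_(k <- msupp v) v@_k *:
    \sum_(j < size (E 'X^(k s))) (E 'X^(k s))`_j *: 'X_[mnm_set k s j].

Definition in_var s (f : {poly K}) : {mpoly K[n]} :=
  (map_poly (@mpolyC n K) f).['X_s].

Lemma factor_actEw s E v (B : nat) : (msize v <= B)%N ->
  factor_act s E v = \sum_(k : 'X_{1..n < B}) v@_k *:
    \sum_(j < size (E 'X^(k s))) (E 'X^(k s))`_j *: 'X_[mnm_set k s j].
Proof.
move=> leB; rewrite /factor_act; pose I : subFinType _ := 'X_{1..n < B}.
rewrite (big_mksub I) /=; first last.
- by move=> x /msize_mdeg_lt /leq_trans; apply.
- by rewrite msupp_uniq.
by rewrite big_rmcond //= => i /memN_msupp_eq0 ->; rewrite scale0r.
Qed.

Lemma factor_act_linear s E : linear (factor_act s E).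
Proof.
move=> c u v.
pose B := maxn (msize (c *: u + v)) (maxn (msize u) (msize v)).
rewrite !(@factor_actEw s E _ B) ?leq_max ?leqnn ?orbT //.
rewrite scaler_sumr -big_split /=; apply: eq_bigr => k _.
by rewrite mcoeffD mcoeffZ scalerDl scalerA.
Qed.

HB.instance Definition _ s E :=
  GRing.isLinear.Build K {mpoly K[n]} {mpoly K[n]} _ (factor_act s E)
    (factor_act_linear s E).

Lemma factor_actX s E k : factor_act s E 'X_[k] =
  \sum_(j < size (E 'X^(k s))) (E 'X^(k s))`_j *: 'X_[mnm_set k s j].
Proof. by rewrite /factor_act msuppX big_seq1 mcoeffX eqxx scale1r. Qed.


Lemma in_varE s f : in_var s f = \sum_(j < size f) f`_j *: 'X_s ^+ j.
Proof.
rewrite /in_var (horner_coef_wide _ (size_poly _ _)).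
by apply: eq_bigr => j _; rewrite coef_map /= mul_mpolyC.
Qed.

Lemma in_var_linear s : linear (in_var s).
Proof.
move=> c f g; rewrite /in_var -mul_polyC rmorphD rmorphM /= map_polyC /=.
by rewrite hornerD hornerM hornerC mul_mpolyC.
Qed.

HB.instance Definition _ s :=
  GRing.isLinear.Build K {poly K} {mpoly K[n]} _ (in_var s) (in_var_linear s).

Definition var_free s v := forall k, k \in msupp v -> k s = 0%N.

Lemma var_free_prod s (f : 'I_n -> {poly K}) :
  var_free s (\prod_(i < n | i != s) in_var i (f i)).
Proof.
apply: (big_ind (var_free s)) => [k|u v Pu Pv k|i nis k].
- by rewrite msupp1 inE => /eqP->; rewrite mnm0E.
- move=> /msuppM_le /allpairsP[[k1 k2] /= [k1u k2v ->]].
  by rewrite mnmDE (Pu _ k1u) (Pv _ k2v).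
rewrite in_varE => kI; apply/eqP; apply: contraLR kI => ks.
rewrite -mcoeff_eq0 raddf_sum /= big1 // => j _.
rewrite mcoeffZ mpolyXn mcoeffX; case: eqP => [jk|_]; last by rewrite mulr0.
by move: ks; rewrite -jk mulmnE mnm1E (negPf nis) mul0n.
Qed.

Lemma factor_act_mul s (E : {linear {poly K} -> {poly K}}) v f :
  var_free s v -> factor_act s E (v * in_var s f) = v * in_var s (E f).
Proof.
move=> vs.
rewrite -[f]coefK poly_def !(linear_sum, mulr_sumr) /=; apply: eq_bigr => j _.
rewrite !linearZ /= -!scalerAr linearZ /=; congr (_ *: _).
rewrite [v in LHS]mpolyE [v in RHS]mpolyE !mulr_suml linear_sum /=.
rewrite [LHS]big_seq [RHS]big_seq; apply: eq_bigr => k /vs ks.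
rewrite -!scalerAl linearZ /=; congr (_ *: _).
have -> : in_var s 'X^j = 'X_[U_(s) *+ j].
  by rewrite /in_var map_polyXn hornerXn mpolyXn.
rewrite -mpolyXD factor_actX.
have -> : (k + U_(s) *+ j)%MM s = j.
  by rewrite mnmDE ks mulmnE mnm1E eqxx mul1n.
rewrite in_varE mulr_sumr; apply: eq_bigr => i _.
rewrite -scalerAr mpolyXn -mpolyXD; congr (_ *: 'X_[_]).
apply/mnmP => t; rewrite mnmE !mnmDE !mulmnE !mnm1E (eq_sym s t).
by case: eqP => [->|_]; rewrite ?ks ?mul0n ?mul1n ?addn0.
Qed.

Lemma factor_act_pure s (E : {linear {poly K} -> {poly K}})
    (f : 'I_n -> {poly K}) :
  factor_act s E (\prod_(i < n) in_var i (f i)) =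
  \prod_(i < n) in_var i (if i == s then E (f i) else f i).
Proof.
rewrite (bigD1 s) //= [RHS](bigD1 s) //= eqxx mulrC factor_act_mul.
  rewrite mulrC; congr (_ * _); apply: eq_bigr => i /negPf nis.
  by rewrite nis.
exact: var_free_prod.
Qed.

End TensorVerma.

Section Gaudin.
Context {K : fieldType} {n : nat}.
Implicit Types (z m : 'I_n -> K) (s r : 'I_n) (a b : 'I_2) (v : {mpoly K[n]}).

(* e_{ab}^{(s)}, the total action of e_{ab}, and Omega_{s,r}. *)
Definition e_at m s a b : {mpoly K[n]} -> {mpoly K[n]} :=
  factor_act s (verma_e (m s) a b).

Definition e_tot m a b v : {mpoly K[n]} := \sum_(s < n) e_at m s a b v.

Definition casimir m s r v : {mpoly K[n]} :=
  \sum_(a < 2) \sum_(b < 2) e_at m s a b (e_at m r b a v).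

(* The shifted Hamiltonians, with m_s m_r - Omega_{s,r} rather than Omega_{s,r}. *)
Definition gaudin z m s v : {mpoly K[n]} :=
  \sum_(r < n | r != s) (z s - z r)^-1 *: ((m s * m r) *: v - casimir m s r v).

(* As e_11 + e_22 acts by sum_s m_s, the e_22-eigenvalue l alone cuts out the
   weight subspace of weight sum_s m_s eps_1 - l (eps_1 - eps_2). *)
Definition Sing m (l : nat) v : Prop :=
  e_tot m 0 1 v = 0 /\ e_tot m 1 1 v = l%:R *: v.

Lemma e_at_linear m s a b : linear (e_at m s a b).
Proof. by move=> c u v; rewrite /e_at linearP. Qed.

HB.instance Definition _ m s a b := GRing.isLinear.Build K {mpoly K[n]}
  {mpoly K[n]} _ (e_at m s a b) (e_at_linear m s a b).

Lemma casimir_linear m s r : linear (casimir m s r).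
Proof.
move=> c u v; rewrite /casimir scaler_sumr -big_split /=.
apply: eq_bigr => a _; rewrite scaler_sumr -big_split /=; apply: eq_bigr => b _.
by rewrite !linearP.
Qed.

Lemma gaudin_linear z m s : linear (gaudin z m s).
Proof.
move=> c u v; rewrite /gaudin scaler_sumr -big_split /=; apply: eq_bigr => r _.
rewrite casimir_linear [(m s * m r) *: (_ + _)]scalerDr opprD addrACA scalerDr.
congr (_ + _).
have -> : (m s * m r) *: (c *: u) = c *: ((m s * m r) *: u).
  by rewrite !scalerA mulrC.
by rewrite -scalerBr !scalerA mulrC.
Qed.

HB.instance Definition _ z m s := GRing.isLinear.Build K {mpoly K[n]}
  {mpoly K[n]} _ (gaudin z m s) (gaudin_linear z m s).

End Gaudin.

(* {mpoly K[n]} (x) W, for a K-vector space W: finitely supported families of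
   elements of W indexed by the monomial basis of {mpoly K[n]}. *)
Notation mtens n W := (monalg.malg (Choice.clone 'X_{1..n} _) W).

(* Locked, as failing conversions through finmap are very slow. *)
HB.lock Definition mtens_coef (n : nat) (W : zmodType) (k : 'X_{1..n})
  (t : mtens n W) : W := monalg.mcoeff k t.

(* The element 'X_[k] (x) w. *)
HB.lock Definition mtens_mon (n : nat) (W : zmodType) (k : 'X_{1..n})
  (w : W) : mtens n W := monalg.mkmalgU k w.

Section Tensor.
Context {K : fieldType} {n : nat} {W : lmodType K}.
Local Notation mtens := (mtens n W).
Implicit Types (v : {mpoly K[n]}) (w : W) (k : 'X_{1..n}) (t : mtens).

Definition mtens_pure v w : mtens :=
  \sum_(k <- msupp v) mtens_mon k (v@_k *: w).

(* T (x) id and id (x) g, for linear maps T and g. *)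
Definition mtens_mapl (T : {mpoly K[n]} -> {mpoly K[n]}) t : mtens :=
  \sum_(k <- monalg.msupp t) mtens_pure (T 'X_[k]) (mtens_coef k t).

Definition mtens_mapr (g : W -> W) t : mtens :=
  \sum_(k <- monalg.msupp t) mtens_mon k (g (mtens_coef k t)).

(* Membership in V (x) W, for V a subspace of {mpoly K[n]}. *)
Definition in_mtens (V : {mpoly K[n]} -> Prop) t : Prop :=
  exists (N : nat) (v : 'I_N -> {mpoly K[n]}) (w : 'I_N -> W),
    (forall i, V (v i)) /\ t = \sum_(i < N) mtens_pure (v i) (w i).

Lemma mtensP t u : (forall k, mtens_coef k t = mtens_coef k u) -> t = u.
Proof. by move=> h; apply/monalg.malgP => k; move: (h k); rewrite mtens_coef.unlock. Qed.

Lemma mtens_coef0 k : mtens_coef k (0 : mtens) = 0.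
Proof. by rewrite mtens_coef.unlock; exact: monalg.fgzeroE. Qed.

Lemma mtens_coefD k t u : mtens_coef k (t + u) = mtens_coef k t + mtens_coef k u.
Proof. by rewrite mtens_coef.unlock; exact: monalg.fgaddE. Qed.

Lemma mtens_coef_sum k (I : Type) (r : seq I) (F : I -> mtens) :
  mtens_coef k (\sum_(i <- r) F i) = \sum_(i <- r) mtens_coef k (F i).
Proof. exact: (big_morph (@mtens_coef n W k) (mtens_coefD k) (mtens_coef0 k)). Qed.

Lemma mtens_coef_mon k j w : mtens_coef k (mtens_mon j w) = w *+ (j == k).
Proof. by rewrite mtens_coef.unlock mtens_mon.unlock; exact: monalg.mcoeffU. Qed.

Lemma mtens_mon0 k : mtens_mon k (0 : W) = 0.
Proof.
by apply: mtensP => j; rewrite mtens_coef_mon mtens_coef0 mul0rn.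
Qed.

Lemma mtens_coef_eq0 k t : (mtens_coef k t == 0) = (k \notin monalg.msupp t).
Proof. by rewrite mtens_coef.unlock; exact: monalg.mcoeff_eq0. Qed.

Lemma mtens_pureE v w k : mtens_coef k (mtens_pure v w) = v@_k *: w.
Proof.
rewrite /mtens_pure mtens_coef_sum.
have [kv|/memN_msupp_eq0 k0] := boolP (k \in msupp v).
  rewrite (bigD1_seq k kv (msupp_uniq v)) mtens_coef_mon eqxx mulr1n.
  rewrite big1; first exact: addr0.
  by move=> i ik; rewrite mtens_coef_mon (negPf ik) mulr0n.
rewrite big1 ?k0 ?scale0r // => i _; rewrite mtens_coef_mon.
by case: eqP => [->|//]; rewrite k0 scale0r mul0rn.
Qed.

Lemma mtensE t :
  t = \sum_(k <- monalg.msupp t) mtens_pure 'X_[k] (mtens_coef k t).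
Proof.
rewrite {1}[t]monalg.monalgE; apply: eq_bigr => k _.
rewrite /mtens_pure msuppX big_seq1 mcoeffX eqxx scale1r.
by rewrite mtens_coef.unlock mtens_mon.unlock.
Qed.

Lemma mtens_pureDl w : {morph mtens_pure^~ w : u v / u + v}.
Proof.
by move=> u v; apply: mtensP => k; rewrite (mtens_pureE (u + v)) mtens_coefD !mtens_pureE mcoeffD scalerDl.
Qed.

Lemma mtens_pureDr v : {morph mtens_pure v : w w' / w + w'}.
Proof.
by move=> u w; apply: mtensP => k; rewrite (mtens_pureE v (u + w)) mtens_coefD !mtens_pureE scalerDr.
Qed.

Lemma mtens_pureZ (c : K) v w : mtens_pure (c *: v) w = mtens_pure v (c *: w).
Proof. by apply: mtensP => k; rewrite !mtens_pureE mcoeffZ scalerA mulrC. Qed.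

Lemma mtens_sumw (U : zmodType) (r : seq 'X_{1..n}) (F : 'X_{1..n} -> U) t :
    uniq r -> {subset monalg.msupp t <= r} ->
    (forall k, mtens_coef k t = 0 -> F k = 0) ->
  \sum_(k <- monalg.msupp t) F k = \sum_(k <- r) F k.
Proof.
move=> ur sr F0.
transitivity (\sum_(k <- r | k \in monalg.msupp t) F k); last first.
  by apply: big_rmcond => k; rewrite -mtens_coef_eq0 => /eqP /F0.
rewrite -[RHS]big_filter; apply: perm_big; apply: uniq_perm.
- exact: finmap.fset_uniq.
- exact: filter_uniq.
by move=> k; rewrite mem_filter andb_idr //; apply: sr.
Qed.

Lemma msupp_mtens_pure v w : {subset monalg.msupp (mtens_pure v w) <= msupp v}.
Proof.
move=> k; apply: contraLR => /memN_msupp_eq0 k0.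
by rewrite -mtens_coef_eq0 mtens_pureE k0 scale0r.
Qed.

Lemma mtens_mapl_pure (T : {linear {mpoly K[n]} -> {mpoly K[n]}}) v w :
  mtens_mapl T (mtens_pure v w) = mtens_pure (T v) w.
Proof.
rewrite /mtens_mapl (@mtens_sumw _ (msupp v)) ?msupp_uniq //; last first.
- by move=> k ->; apply: mtensP => j; rewrite mtens_pureE scaler0 mtens_coef0.
- exact: msupp_mtens_pure.
rewrite [in RHS](mpolyE v) linear_sum /=.
apply: mtensP => j; rewrite mtens_pureE mtens_coef_sum raddf_sum /= scaler_suml.
apply: eq_bigr => k _; rewrite !mtens_pureE.
rewrite [T (_ *: _)]linearZ /=. by rewrite mcoeffZ scalerA mulrC.
Qed.

Lemma mtens_mapr_pure (g : {linear W -> W}) v w :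
  mtens_mapr g (mtens_pure v w) = mtens_pure v (g w).
Proof.
rewrite /mtens_mapr (@mtens_sumw _ (msupp v)) ?msupp_uniq //; last first.
- by move=> k ->; rewrite linear0 mtens_mon0.
- exact: msupp_mtens_pure.
by apply: eq_bigr => k _; rewrite mtens_pureE linearZ.
Qed.

End Tensor.

Section FieldIdentities.
Context {L : fieldType}.

Local Lemma fracE (a b c : L) : a != 0 -> c * b = a * b * (c / a).
Proof. by move=> nz; field. Qed.

Local Lemma distrE (A : comNzRingType) (F : {rmorphism A -> L})
    (p a b x y w : A) (a' b' : L) : F a = F p * a' -> F b = F p * b' ->
  F (p * x - a * y + b * w) = F p * (F x - a' * F y + b' * F w).
Proof. by move=> Fa Fb; rewrite rmorphD rmorphB !rmorphM Fa Fb; ring. Qed.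

End FieldIdentities.

Local Lemma comp_mpolyA (A : comNzRingType) (l : nat) (w : {mpoly A[l]})
    (T U : l.-tuple {mpoly A[l]}) :
  (w \mPo T) \mPo U = w \mPo [tuple tnth T i \mPo U | i < l].
Proof.
rewrite [w \mPo T]comp_mpolyE [RHS]comp_mpolyE raddf_sum; apply: eq_bigr => k _ /=.
rewrite comp_mpolyZ rmorph_prod; congr (_ *: _); apply: eq_bigr => i _ /=.
by rewrite rmorphXn tnth_mktuple.
Qed.

(* x^l + c_1 x^(l-1) + ... + c_l, where [c i] is c_(i+1). *)
Definition monic_of (B : nzRingType) (l : nat) (c : 'I_l -> B) : {poly B} :=
  'X^l + \sum_(i < l) (c i)%:P * 'X^(l - i.+1).

Local Lemma eq_monic_of (B : nzRingType) (l : nat) (c d : 'I_l -> B) :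
  c =1 d -> monic_of c = monic_of d.
Proof.
by move=> cd; congr (_ + _); apply: eq_bigr => i _; rewrite cd.
Qed.

Local Lemma viete (B : idomainType) (l : nat) (cs : l.-tuple B) :
  monic_of (fun i : 'I_l => (-1) ^+ i.+1 * (mesym l B i.+1).@[tnth cs])
  = \prod_(c <- cs) ('X - c%:P).
Proof.
have sz : size (\prod_(c <- cs) ('X - c%:P)) = l.+1.
  by rewrite size_prod_XsubC size_tuple.
apply/polyP => k; rewrite /monic_of coefD coefXn coef_sum.
have [lk|kl] := ltnP l k.
  rewrite gtn_eqF // add0r [RHS]nth_default ?sz // big1 // => i _.
  by rewrite coefCM coefXn gtn_eqF ?mulr0 // (leq_ltn_trans (leq_subr _ _)).
have jl : (l - k < l.+1)%N by rewrite ltnS leq_subr.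
have := mroots_coeff cs (Ordinal jl); rewrite /= subKn // => ->.
move: kl; rewrite leq_eqVlt => /orP[/eqP->|kl].
  rewrite eqxx subnn expr0 mul1r mesym0E meval1 big1 ?addr0 // => i _.
  rewrite coefCM coefXn gtn_eqF ?mulr0 // ltn_subrL /=.
  exact: leq_ltn_trans (ltn_ord i).
have il : (l - k.+1 < l)%N by rewrite ltn_subrL (leq_ltn_trans _ kl).
rewrite ltn_eqF // add0r (bigD1 (Ordinal il)) //= big1 ?addr0.
  by rewrite coefCM coefXn /= -subSn // subSS subKn ?eqxx ?mulr1 // ltnW.
move=> i ni; rewrite coefCM coefXn; case: eqP => [ki|]; rewrite ?mulr0 //.
case/eqP: ni; apply: val_inj => /=; rewrite ki -subSn ?subSS ?subKn //.
by rewrite ltnW.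
Qed.

Local Lemma meval_mesymX (A : comNzRingType) (l i : nat) :
  (mesym l {mpoly A[l]} i).@[tnth [tuple 'X_j | j < l]] = mesym l A i.
Proof.
rewrite /mesym !raddf_sum; apply: eq_bigr => h _ /=.
rewrite rmorph_prod; apply: eq_bigr => j _ /=.
by rewrite mevalXU tnth_mktuple.
Qed.

Local Lemma monic_roots_mpoly (A : idomainType) (l : nat) :
  monic_of (tnth [tuple (-1) ^+ i.+1 *: mesym l A i.+1 | i < l])
  = \prod_(j < l) ('X - ('X_j)%:P) :> {poly {mpoly A[l]}}.
Proof.
pose cs := [tuple 'X_j : {mpoly A[l]} | j < l].
have csE : \prod_(c <- cs) ('X - c%:P) = \prod_(j < l) ('X - ('X_j)%:P).
  by rewrite big_tuple; apply: eq_bigr => j _; rewrite tnth_mktuple.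
apply: etrans _ csE; apply: etrans _ (viete cs).
apply: eq_monic_of => i; rewrite tnth_mktuple meval_mesymX.
by rewrite -mul_mpolyC rmorphXn rmorphN1.
Qed.

Local Lemma signXX (A : comNzRingType) (l : nat) (i : nat) (x : {mpoly A[l]}) :
  (-1 : A) ^+ i *: ((-1 : A) ^+ i *: x) = x.
Proof. by rewrite scalerA -signr_odd -signr_addb addbb scale1r. Qed.

Local Lemma sym_signed (A : comNzRingType) (l : nat) (f : {mpoly A[l]}) :
    f \is symmetric ->
  (symf f \mPo [tuple (-1) ^+ i.+1 *: 'X_i | i < l])
    \mPo [tuple (-1) ^+ i.+1 *: mesym l A i.+1 | i < l] = f.
Proof.
move=> fs; rewrite comp_mpolyA [RHS](symfP fs); congr (_ \mPo _).
apply: eq_from_tnth => i; rewrite !tnth_mktuple comp_mpolyZ comp_mpolyXU.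
by rewrite -tnth_nth tnth_mktuple signXX.
Qed.

Local Lemma sym_signed_uniq (A : comNzRingType) (l : nat) (f w : {mpoly A[l]}) :
    f \is symmetric ->
    w \mPo [tuple (-1) ^+ i.+1 *: mesym l A i.+1 | i < l] = f ->
  w = symf f \mPo [tuple (-1) ^+ i.+1 *: 'X_i | i < l].
Proof.
move=> fs; pose T : l.-tuple {mpoly A[l]} := [tuple (-1) ^+ i.+1 *: 'X_i | i < l].
have -> : w \mPo [tuple (-1) ^+ i.+1 *: mesym l A i.+1 | i < l] =
    (w \mPo T) \mPo [tuple mesym l A i.+1 | i < l].
  rewrite comp_mpolyA; congr (_ \mPo _); apply: eq_from_tnth => i.
  by rewrite !tnth_mktuple comp_mpolyZ comp_mpolyXU -tnth_nth tnth_mktuple.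
rewrite {1}(symfP fs) => /msym_fundamental_un <-.
rewrite comp_mpolyA -[LHS]comp_mpoly_id; congr (_ \mPo _).
apply: eq_from_tnth => i; rewrite !tnth_mktuple comp_mpolyZ comp_mpolyXU.
by rewrite -tnth_nth tnth_mktuple signXX.
Qed.

Section AD.
Context {K : fieldType} {n l : nat}.
Implicit Types (z m : 'I_n -> K) (s : 'I_n).

(* K[a_1, ..., a_l, h_1, ..., h_n]; [avar i] is a_(i+1), as ordinals start at 0. *)
Local Notation P := {mpoly K[l + n]}.

Definition avar (i : 'I_l) : P := 'X_(lshift n i).
Definition hvar s : P := 'X_(rshift l s).

Definition pgen : {poly P} := monic_of avar.

Definition lin z s : {poly P} := 'X - ((z s)%:MP)%:P.

(* prod_r (x - z_r) * sum_s c_s / (x - z_s) *)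
Definition clear_den z (c : 'I_n -> P) : {poly P} :=
  \sum_(s < n) (c s)%:P * \prod_(r < n | r != s) lin z r.

(* D_h with its denominators cleared against the leading product; see [DhE],
   whose F may be the embedding of {poly P} in its fraction field. *)
Definition Dh z m (f : {poly P}) : {poly P} :=
  (\prod_(r < n) lin z r) * f^`()^`()
  - clear_den z (fun s => (m s)%:MP) * f^`()
  + clear_den z hvar * f.

Lemma clear_denE z c (L : fieldType) (F : {rmorphism {poly P} -> L}) :
    (forall s, F (lin z s) != 0) ->
  F (clear_den z c) =
  F (\prod_(s < n) lin z s) * \sum_(s < n) F (c s)%:P / F (lin z s).
Proof.
move=> nz; rewrite rmorph_sum mulr_sumr; apply: eq_bigr => s _.
rewrite [in RHS](bigD1 s) //= !rmorphM /=.
exact: fracE (nz s).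
Qed.

Lemma DhE z m f (L : fieldType) (F : {rmorphism {poly P} -> L}) :
    (forall s, F (lin z s) != 0) ->
  F (Dh z m f) =
  F (\prod_(s < n) lin z s) *
    (F f^`()^`() - (\sum_(s < n) F ((m s)%:MP)%:P / F (lin z s)) * F f^`()
     + (\sum_(s < n) F (hvar s)%:P / F (lin z s)) * F f).
Proof. by move=> nz; apply: distrE; apply: clear_denE nz. Qed.

Definition qm1 : P := \sum_(s < n) hvar s.
Definition q0 z m : P :=
  \sum_(s < n) z s *: hvar s - (l%:R * (\sum_(s < n) m s + 1 - l%:R))%:MP.
Definition qi z m (i : nat) : P := (Dh z m pgen)`_(l + n - 2 - i).

Definition ID_gens z m : seq P :=
  qm1 :: q0 z m :: [seq qi z m i | i <- iota 1 (l + n - 2)].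

Definition AD z m := gen_quot (ID_gens z m).
Definition AD_pi z m (f : P) : AD z m := gen_pi (ID_gens z m) f.

HB.instance Definition _ z m := GRing.ComPzRing.on (AD z m).
HB.instance Definition _ z m := GRing.Lmodule.on (AD z m).

(* The universal weight function as a polynomial in t_1, ..., t_l, i.e. as an
   element of {mpoly K[n]} (x) K[t_1, ..., t_l]; 'X_s stands for x^(s). *)
Definition omega_t z : {mpoly {mpoly K[n]}[l]} :=
  \prod_(j < l) \sum_(s < n) ('X_s : {mpoly K[n]}) *:
     \prod_(i < n | i != s) ('X_j - ((z i)%:MP)%:MP).

(* The same as a polynomial in a, an element of {mpoly K[n]} (x) K[a]: [symf]
   expresses a symmetric polynomial through the elementary symmetric ones, and
   e_(i+1) = (-1)^(i+1) a_(i+1); see [omega_aP], [omega_a_uniq], [monic_rootsE]. *)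
Definition omega_a z : {mpoly {mpoly K[n]}[l]} :=
  symf (omega_t z) \mPo [tuple (-1) ^+ i.+1 *: 'X_i | i < l].

Definition omegaD z m : mtens n (AD z m) :=
  \sum_(k <- msupp (omega_a z))
    mtens_pure (omega_a z)@_k (AD_pi z m (\prod_(i < l) avar i ^+ k i)).

Lemma omega_t_sym z : omega_t z \is symmetric.
Proof.
apply/issymP => g; rewrite /omega_t rmorph_prod /=.
have XE j : msym g ('X_j : {mpoly {mpoly K[n]}[l]}) = 'X_(g j).
  rewrite msymX; congr 'X_[_]; apply/mnmP => i.
  by rewrite mnmE !mnm1E -(inj_eq (@perm_inj _ g)) permKV.
rewrite [RHS](reindex_inj (@perm_inj _ g)) /=; apply: eq_bigr => j _.
rewrite raddf_sum; apply: eq_bigr => s _ /=.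
rewrite msymZ rmorph_prod; congr (_ *: _); apply: eq_bigr => i _ /=.
by rewrite msymB XE -[_%:MP]mulr1 mul_mpolyC msymZ msym1.
Qed.

Definition a_of_t : l.-tuple {mpoly {mpoly K[n]}[l]} :=
  [tuple (-1) ^+ i.+1 *: mesym l {mpoly K[n]} i.+1 | i < l].

Lemma monic_rootsE :
  monic_of (tnth a_of_t) = \prod_(j < l) ('X - ('X_j)%:P).
Proof. exact: monic_roots_mpoly. Qed.

Lemma omega_aP z : omega_a z \mPo a_of_t = omega_t z.
Proof. exact/sym_signed/omega_t_sym. Qed.

Lemma omega_a_uniq z (w : {mpoly {mpoly K[n]}[l]}) :
  w \mPo a_of_t = omega_t z -> w = omega_a z.
Proof. exact/sym_signed_uniq/omega_t_sym. Qed.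

End AD.

(* Main.v *)
Require Import Defs.
From HB Require Import structures.
From mathcomp Require Import all_boot all_order all_algebra.
From mathcomp Require Import generic_quotient ring_quotient.
From mathcomp Require Import complex reals mpoly ring zify.
From mathcomp Require finmap monalg.
Import (canonicals, coercions) finmap.
Import (canonicals, coercions) monalg.
Import GRing.Theory Num.Theory.

Set Implicit Arguments.
Unset Strict Implicit.
Unset Printing Implicit Defensive.

Local Open Scope ring_scope.

(* Sklyanin's separation of variables.  As differential operators in x, the
   Hamiltonians satisfy, at each root y of F_x(u) = sum_s x_s prod_(i != s) (u - z_i),
     d^2/dy^2 - (sum_s m_s / (y - z_s)) d/dy + sum_s H_s / (y - z_s) = 0,
   where d/dy moves the single root y, i.e. moves x along the line
   x_s = a_s (y - z_s) with sum_s a_s = 0.  On this line F_x(t) = (y - t) F_a(t),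
   so omega, the product of the F_x(t_j), equals p(y) omega(a) and D_h(p)(y) = 0
   gives sum_s (H_s - h_s) omega / (y - z_s) = 0.  Together with
   sum_s H_s = 0 = sum_s h_s, the n - 1 roots y of F_x force H_s omega = h_s omega
   at x whenever these roots are distinct and avoid the z_s, hence everywhere.
   Finally sum_s z_s H_s = l (sum_s m_s + 1 - l) - e_21 e_12 on the weight
   subspace and q_0 = 0 give e_12 omega = 0. *)

(** * Vector-valued polynomials *)

Section VectorPolynomials.
Context {K : numFieldType} {W : lmodType K}.

(** The coefficients are vectors, so instead of counting roots one inverts the Vandermonde matrix of
    the points, which recovers each [w i] from the values. *)
Lemma vpoly_eq0 N (c : 'I_N -> K) (w : 'I_N -> W) :
    injective c -> (forall j, \sum_(i < N) c j ^+ i *: w i = 0) ->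
  forall i, w i = 0.
Proof.
move=> c_inj c0 k; pose V := Vandermonde N (\row_j c j).
have Vu : V \in unitmx.
  rewrite unitmxE det_Vandermonde unitfE; apply/prodf_neq0 => i _.
  apply/prodf_neq0 => j ij; rewrite !mxE subr_eq0 (inj_eq c_inj).
  by rewrite neq_ltn orbC ij.
transitivity (\sum_(i < N) (V *m invmx V) i k *: w i).
  rewrite mulmxV // (bigD1 k) //= mxE eqxx scale1r big1 ?addr0 // => i ik.
  by rewrite mxE (negPf ik) scale0r.
transitivity (\sum_(j < N) invmx V j k *: \sum_(i < N) c j ^+ i *: w i).
  under eq_bigr do rewrite mxE scaler_suml.
  rewrite exchange_big; apply: eq_bigr => j _.
  rewrite scaler_sumr; apply: eq_bigr => i _.
  by rewrite scalerA mulrC !mxE.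
by rewrite big1 // => j _; rewrite c0 scaler0.
Qed.

Lemma vpoly_generic_eq0 (B : {poly K}) N (w : 'I_N -> W) :
    B != 0 -> (forall c, B.[c] != 0 -> \sum_(i < N) c ^+ i *: w i = 0) ->
  forall i, w i = 0.
Proof.
(* Fewer than [size B] of these integers are roots of [B], so at least N good points remain; they
   are distinct in characteristic 0. *)
move=> B0 Bw; pose s : seq K := [seq k%:R | k <- iota 0 (N + size B)].
have us : uniq s by rewrite map_inj_uniq ?iota_uniq //; apply: mulrIn; exact: oner_neq0.
pose s' := [seq c <- s | ~~ root B c].
have sz : (N <= size s')%N.
  have : (size [seq c <- s | root B c] < size B)%N.
    by apply: max_poly_roots; rewrite ?filter_all ?filter_uniq.
  rewrite /s' !size_filter => szr; have := count_predC (root B) s.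
  rewrite [size s]size_map size_iota addnC => /esym sE.
  by rewrite -(leq_add2r (size B)) sE leq_add2l ltnW.
apply: (@vpoly_eq0 _ (fun i : 'I_N => s'`_i)) => [i j /eqP|j].
  rewrite nth_uniq ?filter_uniq ?(leq_trans _ sz) // => /eqP ij.
  exact: val_inj.
apply: Bw; have : s'`_j \in s' by rewrite mem_nth // (leq_trans _ sz).
by rewrite mem_filter => /andP[].
Qed.

(** Clearing denominators turns the sum into a vector-valued polynomial of degree at most n. Its top
    coefficient is [\sum_s g s], so it has degree below n and n distinct zeros, hence vanishes; its
    value at z_s is a nonzero multiple of [g s]. *)
Lemma partial_fractions_eq0 n (z : 'I_n.+1 -> K)
    (y : 'I_n -> K) (g : 'I_n.+1 -> W) :
    injective z -> injective y -> (forall k s, y k != z s) ->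
    \sum_s g s = 0 -> (forall k, \sum_s (y k - z s)^-1 *: g s = 0) ->
  forall s, g s = 0.
Proof.
move=> z_inj y_inj yz g0 gy s.
pose A r : {poly K} := \prod_(i < n.+1 | i != r) ('X - (z i)%:P).
have szA r : size (A r) = n.+1.
  rewrite /A -big_filter size_prod_XsubC -sum1_size big_filter.
  by rewrite sum1_card cardC1 card_ord.
have An r : (A r)`_n = 1.
  have := monic_prod_XsubC (index_enum 'I_n.+1) (predC1 r) z.
  by rewrite -/(A r) monicE lead_coefE szA => /eqP.
pose w i := \sum_r (A r)`_i *: g r.
have wn : w n = 0.
  by rewrite -[RHS]g0; apply: eq_bigr => r _; rewrite An scale1r.
have wA c : \sum_(i < n.+1) c ^+ i *: w i = \sum_r (A r).[c] *: g r.
  under eq_bigr do rewrite scaler_sumr.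
  rewrite exchange_big; apply: eq_bigr => r _ /=.
  rewrite (@horner_coef_wide _ n.+1) ?szA // scaler_suml.
  by apply: eq_bigr => i _; rewrite scalerA mulrC.
have w0 i : (i < n)%N -> w i = 0.
  move=> lin; apply: (@vpoly_eq0 n y w y_inj _ (Ordinal lin)) => k.
  have := wA (y k); rewrite big_ord_recr /= wn scaler0 addr0 => ->.
  transitivity ((\prod_i (y k - z i)) *: \sum_r (y k - z r)^-1 *: g r); last first.
    by rewrite gy scaler0.
  rewrite scaler_sumr.
  apply: eq_bigr => r _; rewrite scalerA; congr (_ *: _).
  rewrite [\prod_i (y k - z i)](bigD1 r) //= mulrAC divff ?subr_eq0 // mul1r horner_prod.
  by apply: eq_bigr => j _; rewrite hornerXsubC.
have := wA (z s); rewrite big1 => [|i _]; last first.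
  have [->|] := eqVneq (val i) n; first by rewrite wn scaler0.
  by move=> nin; rewrite w0 ?scaler0 // ltn_neqAle nin -ltnS ltn_ord.
rewrite (bigD1 s) //= big1 ?addr0 => [/esym/eqP|r rs]; last first.
  rewrite /A (bigD1 s) 1?eq_sym //= hornerM hornerXsubC subrr mul0r.
  by rewrite scale0r.
rewrite scaler_eq0 => /orP[|/eqP //]; rewrite horner_prod.
move/prodf_eq0 => [i si]; rewrite hornerXsubC subr_eq0 (inj_eq z_inj).
by rewrite eq_sym (negPf si).
Qed.

End VectorPolynomials.

(** * Linear maps on tensors, and kernels of their extensions *)

Section TensorMaps.
Context {K : fieldType} {n : nat} {W : lmodType K}.
Implicit Types (t u : mtens n W) (v : {mpoly K[n]}) (w : W).

(** [mtens_mapl], [mtens_mapr] and [mtens_eval] are sums over a support, which changes under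
    addition. Rewriting all three sums over the union of both supports makes additivity termwise. *)
Lemma mtens_sumD (U : zmodType) (F : 'X_{1..n} -> W -> U) t u :
    (forall k, {morph F k : v w / v + w}) ->
  \sum_(k <- monalg.msupp (t + u)) F k (mtens_coef k (t + u)) =
  \sum_(k <- monalg.msupp t) F k (mtens_coef k t) +
  \sum_(k <- monalg.msupp u) F k (mtens_coef k u).
Proof.
move=> FD; pose r := undup (monalg.msupp t ++ monalg.msupp u : seq 'X_{1..n}).
have F0 k : F k 0 = 0 by apply: (addrI (F k 0)); rewrite -FD !addr0.
have sr k : (k \in r) = (k \in monalg.msupp t) || (k \in monalg.msupp u).
  by rewrite mem_undup mem_cat.
have E t' : {subset monalg.msupp t' <= r} ->
    \sum_(k <- monalg.msupp t') F k (mtens_coef k t') =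
    \sum_(k <- r) F k (mtens_coef k t').
  move=> tr; apply: (@mtens_sumw _ _ _ _ r (fun k => F k (mtens_coef k t'))) => //.
    exact: undup_uniq.
  by move=> k ->; rewrite F0.
rewrite !E.
- by rewrite -big_split; apply: eq_bigr => k _; rewrite mtens_coefD FD.
- by move=> k; rewrite sr => ->; rewrite orbT.
- by move=> k; rewrite sr => ->.
move=> k; apply: contraLR; rewrite sr negb_or -!mtens_coef_eq0.
by case/andP=> /eqP t0 /eqP u0; rewrite mtens_coefD t0 u0 addr0.
Qed.

Lemma mtens_monD k : {morph (mtens_mon k : W -> mtens n W) : w w' / w + w'}.
Proof.
move=> w w'; apply: mtensP => j.
by rewrite mtens_coefD !mtens_coef_mon mulrnDl.
Qed.

Lemma mtens_mapl_sum (T : {linear {mpoly K[n]} -> {mpoly K[n]}}) (I : Type)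
    (r : seq I) (v : I -> {mpoly K[n]}) (w : I -> W) :
  mtens_mapl T (\sum_(i <- r) mtens_pure (v i) (w i)) =
  \sum_(i <- r) mtens_pure (T (v i)) (w i).
Proof.
have TD : {morph (mtens_mapl T : mtens n W -> _) : t u / t + u}.
  move=> t u; apply: (@mtens_sumD _ (fun k w => mtens_pure (T 'X_[k]) w)).
  by move=> k; exact: mtens_pureDr.
have T0 : mtens_mapl T (0 : mtens n W) = 0.
  by apply: (addrI (mtens_mapl T 0)); rewrite -TD !addr0.
rewrite (big_morph _ TD T0); apply: eq_bigr => i _; exact: mtens_mapl_pure.
Qed.

Lemma mtens_mapr_sum (g : {linear W -> W}) (I : Type)
    (r : seq I) (v : I -> {mpoly K[n]}) (w : I -> W) :
  mtens_mapr g (\sum_(i <- r) mtens_pure (v i) (w i)) =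
  \sum_(i <- r) mtens_pure (v i) (g (w i)).
Proof.
have gD : {morph (mtens_mapr g : mtens n W -> _) : t u / t + u}.
  move=> t u; apply: (@mtens_sumD _ (fun k w => mtens_mon k (g w))).
  by move=> k a b; rewrite linearD mtens_monD.
have g0 : mtens_mapr g (0 : mtens n W) = 0.
  by apply: (addrI (mtens_mapr g 0)); rewrite -gD !addr0.
rewrite (big_morph _ gD g0); apply: eq_bigr => i _; exact: mtens_mapr_pure.
Qed.

Lemma mtens_pure_sumr v (I : Type) (r : seq I) (w : I -> W) :
  mtens_pure v (\sum_(i <- r) w i) = \sum_(i <- r) mtens_pure v (w i).
Proof.
apply: (big_morph _ (mtens_pureDr v)); apply: mtensP => k.
by rewrite mtens_pureE scaler0 mtens_coef0.
Qed.

(* A relation with a nonzero coefficient among the [w i] shortens the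
   expression of the tensor; without one, all [v i] are in both kernels. *)
Lemma in_mtens_ker2 (S T : {linear {mpoly K[n]} -> {mpoly K[n]}}) N
    (v : 'I_N -> {mpoly K[n]}) (w : 'I_N -> W) :
    \sum_(i < N) mtens_pure (S (v i)) (w i) = 0 ->
    \sum_(i < N) mtens_pure (T (v i)) (w i) = 0 ->
  in_mtens (fun f => S f = 0 /\ T f = 0) (\sum_(i < N) mtens_pure (v i) (w i)).
Proof.
elim: N v w => [|N IHN] v w S0 T0.
  by exists 0, v, w; split=> // -[].
have [/forallP ST0|] := boolP [forall i, (S (v i) == 0) && (T (v i) == 0)].
  exists N.+1, v, w; split=> // i.
  by have /andP[/eqP -> /eqP ->] := ST0 i.
rewrite negb_forall => /existsP[i STi].
suff [c [ci cw]] : exists c : 'I_N.+1 -> K, c i != 0 /\ \sum_j c j *: w j = 0.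
  (* Solving the relation for [w i] and substituting replaces each other [v j] by
     [v j - (c j / c i) v i]. *)
  pose d j := c (lift i j) / c i.
  pose v' j := v (lift i j) - d j *: v i.
  have wi : w i = - \sum_j d j *: w (lift i j).
    have /(congr1 ( *:%R (c i)^-1)) := cw; rewrite scaler0 scaler_sumr (bigD1_ord i) //=.
    rewrite scalerA mulVf // scale1r => /eqP; rewrite addr_eq0 => /eqP ->.
    by congr (- _); apply: eq_bigr => j _; rewrite scalerA /d mulrC.
  have shorten (U : {linear {mpoly K[n]} -> {mpoly K[n]}}) :
      \sum_j mtens_pure (U (v j)) (w j) =
      \sum_j mtens_pure (U (v' j)) (w (lift i j)).
    rewrite (bigD1_ord i) //= wi -sumrN mtens_pure_sumr -big_split.
    apply: eq_bigr => j _; rewrite /= -scaleNr -mtens_pureZ -mtens_pureDl.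
    by congr mtens_pure; rewrite /v' linearB linearZ /= scaleNr addrC.
  (* [U := idfun] rewrites the tensor itself; [U := S] and [U := T] carry the two hypotheses over to
     the shorter expression. *)
  have := shorten idfun; rewrite /= => ->.
  by apply: IHN; rewrite -shorten.
have coef0 (U : {linear {mpoly K[n]} -> {mpoly K[n]}}) :
    \sum_j mtens_pure (U (v j)) (w j) = 0 -> U (v i) != 0 ->
    exists c : 'I_N.+1 -> K, c i != 0 /\ \sum_j c j *: w j = 0.
  (* One monomial coefficient of the vanishing tensor is a linear relation among the [w j]; the
     leading monomial of [U (v i)] makes its i-th coefficient nonzero. *)
  move=> U0 Ui; exists (fun j => (U (v j))@_(mlead (U (v i)))); split.
    by rewrite mleadc_eq0.
  have /(congr1 (mtens_coef (mlead (U (v i))))) := U0.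
  rewrite mtens_coef_sum mtens_coef0 => U0'; rewrite -[RHS]U0'.
  by apply: eq_bigr => j _; rewrite mtens_pureE.
by move: STi; rewrite negb_and => /orP[]; apply: coef0.
Qed.

End TensorMaps.

(** * Evaluation of the polynomial factor of a tensor at points *)

Section TensorEvaluation.
Context {K : numFieldType} {n : nat} {W : lmodType K}.
Implicit Types (x : 'I_n -> K) (t u : mtens n W).

Definition mtens_eval x t : W :=
  \sum_(k <- monalg.msupp t) (\prod_(i < n) x i ^+ k i) *: mtens_coef k t.

Lemma mtens_evalw x t (r : seq 'X_{1..n}) :
    uniq r -> {subset monalg.msupp t <= r} ->
  mtens_eval x t = \sum_(k <- r) (\prod_(i < n) x i ^+ k i) *: mtens_coef k t.
Proof.
by move=> ur sr; apply: mtens_sumw => // k ->; rewrite scaler0.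
Qed.

Lemma mtens_evalD x : {morph mtens_eval x : t u / t + u}.
Proof.
move=> t u; apply: (@mtens_sumD _ _ _ _ (fun k w => (\prod_(i < n) x i ^+ k i) *: w)).
by move=> k v w; rewrite scalerDr.
Qed.

Lemma mtens_eval0 x : mtens_eval x 0 = 0.
Proof. by apply: (addrI (mtens_eval x 0)); rewrite -mtens_evalD !addr0. Qed.

Lemma mtens_eval_sum x (I : Type) (r : seq I) (F : I -> mtens n W) :
  mtens_eval x (\sum_(i <- r) F i) = \sum_(i <- r) mtens_eval x (F i).
Proof. exact: (big_morph (mtens_eval x) (mtens_evalD x) (mtens_eval0 x)). Qed.

Lemma mtens_eval_pure x v (w : W) : mtens_eval x (mtens_pure v w) = v.@[x] *: w.
Proof.
rewrite (@mtens_evalw x _ (msupp v)) ?msupp_uniq //; last first.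
  exact: msupp_mtens_pure.
rewrite mevalE scaler_suml; apply: eq_bigr => k _.
by rewrite mtens_pureE scalerA mulrC.
Qed.

Lemma eq_mtens_eval x y t : x =1 y -> mtens_eval x t = mtens_eval y t.
Proof.
move=> xy; apply: eq_bigr => k _; congr (_ *: _).
by apply: eq_bigr => i _; rewrite xy.
Qed.

Lemma mtens_eval_curve (X : 'I_n -> {poly K}) t :
  exists N (w : 'I_N -> W), forall c,
    mtens_eval (fun i => (X i).[c]) t = \sum_(j < N) c ^+ j *: w j.
Proof.
pose r : seq 'X_{1..n} := monalg.msupp t.
pose p (k : 'X_{1..n}) := \prod_(i < n) X i ^+ k i.
exists (\max_(k <- r) size (p k)), (fun j => \sum_(k <- r) (p k)`_j *: mtens_coef k t).
move=> c; under [RHS]eq_bigr do rewrite scaler_sumr.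
rewrite exchange_big /mtens_eval [LHS]big_seq [RHS]big_seq; apply: eq_bigr => k kr.
have -> : \prod_(i < n) (X i).[c] ^+ k i = (p k).[c].
  by rewrite horner_prod; apply: eq_bigr => i _; rewrite horner_exp.
rewrite (@horner_coef_wide _ (\max_(k <- r) size (p k))); last first.
  by rewrite (big_rem _ kr) leq_maxl.
by rewrite scaler_suml; apply: eq_bigr => j _; rewrite scalerA mulrC.
Qed.

(** Along a polynomial curve the value of a tensor is a vector-valued polynomial in the parameter,
    so vanishing at generic parameters extends to special ones such as 0. *)
Lemma mtens_eval_curve_eq0 (X : 'I_n -> {poly K}) t (B : {poly K}) :
    B != 0 ->
    (forall c, B.[c] != 0 -> mtens_eval (fun i => (X i).[c]) t = 0) ->
  forall c, mtens_eval (fun i => (X i).[c]) t = 0.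
Proof.
move=> B0 Bt; have [N [w tw]] := mtens_eval_curve X t.
have w0 := @vpoly_generic_eq0 _ _ B N w B0 _.
move=> c; rewrite tw big1 // => j _; rewrite w0 ?scaler0 // => d Bd.
by rewrite -tw Bt.
Qed.

End TensorEvaluation.

(** * A tensor is determined by its values at points with nonzero coordinate sum *)

Lemma digits_inj (b n : nat) (f g : nat -> nat) :
    (forall i, f i < b)%N -> (forall i, g i < b)%N ->
    (\sum_(i < n) f i * b ^ i = \sum_(i < n) g i * b ^ i)%N ->
  forall i, (i < n)%N -> f i = g i.
Proof.
elim: n f g => // n IHn f g fb gb.
have b0 : (0 < b)%N := leq_ltn_trans (leq0n _) (fb 0).
have E (h : nat -> nat) : (\sum_(i < n.+1) h i * b ^ i =
    (\sum_(i < n) h i.+1 * b ^ i) * b + h 0)%N.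
  rewrite big_ord_recl /= expn0 muln1 addnC big_distrl; congr (_ + _)%N.
  by apply: eq_bigr => i _; rewrite /bump /= add1n expnSr mulnA.
rewrite !E => fg.
have fg0 : f 0 = g 0.
  by have /(congr1 (modn^~ b)) := fg; rewrite !modnMDl !modn_small.
move: fg; rewrite fg0 => /addIn /eqP; rewrite eqn_pmul2r // => /eqP fg [//|i].
by move=> ?; apply: (IHn (fun i => f i.+1) (fun i => g i.+1)).
Qed.

Section Density.
Context {K : numFieldType} {n : nat} {W : lmodType K}.

(* Kronecker's substitution x_i = c^(b^i), with b larger than all exponents of
   [t], is injective on the monomials of [t]. *)
Lemma mtens_eval_inj (t : mtens n W) :
    (forall x, ((0 < n)%N -> \sum_(i < n) x i != 0) -> mtens_eval x t = 0) ->
  t = 0.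
Proof.
move=> t0; pose r : seq 'X_{1..n} := monalg.msupp t.
pose b := (\max_(k <- r) mdeg k).+1.
pose e (k : 'X_{1..n}) := (\sum_(i < n) k i * b ^ i)%N.
have kb k i : k \in r -> (k i < b)%N.
  move=> kr; rewrite ltnS (big_rem _ kr); apply: leq_trans (leq_maxl _ _).
  by rewrite mdegE (bigD1 i) //= leq_addr.
have e_inj : {in r &, injective e}.
  move=> k k' kr kr' ee; apply/mnmP => i.
  pose f (q : 'X_{1..n}) j := if insub j is Some o then q o else 0%N.
  have fE q (o : 'I_n) : f q o = q o by rewrite /f valK.
  have fb q : q \in r -> forall j, (f q j < b)%N.
    by move=> qr j; rewrite /f; case: insubP => // o _ _; exact: kb.
  rewrite -!fE; apply: (@digits_inj b n) (fb _ kr) (fb _ kr') _ _ (ltn_ord i).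
  have fe q : (\sum_(j < n) f q j * b ^ j)%N = e q.
    by apply: eq_bigr => o _; rewrite fE.
  by rewrite !fe.
pose X i : {poly K} := 'X^(b ^ val (i : 'I_n)).
have X0 c : mtens_eval (fun i => (X i).[c]) t = 0.
  (* [B] cuts out the parameters whose point has coordinate sum zero. It is nonzero because its
     value at 1 is n, or 1 when n = 0. *)
  pose B : {poly K} := if n == 0%N then 1 else \sum_i X i.
  apply: (@mtens_eval_curve_eq0 _ _ _ X t B) => [|d Bd].
    apply/eqP => /(congr1 (horner^~ 1)); rewrite horner0 /B.
    have [n0|n0] := eqVneq n 0%N; first by rewrite hornerC; apply/eqP/oner_neq0.
    rewrite horner_sum; under eq_bigr do rewrite hornerXn expr1n.
    by rewrite sumr_const card_ord; apply/eqP; rewrite pnatr_eq0.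
  apply: t0 => n0; rewrite -horner_sum; move: Bd.
  by rewrite /B -[n == 0%N]negbK -lt0n n0.
pose N := (\max_(k <- r) e k).+1.
pose w (j : 'I_N) := \sum_(k <- r | e k == j) mtens_coef k t.
have w0 : forall j, w j = 0.
  apply: (@vpoly_generic_eq0 _ _ 1) => [|c _]; first exact: oner_neq0.
  apply: etrans (X0 c); rewrite /mtens_eval -/r.
  under eq_bigr do rewrite /w scaler_sumr.
  rewrite (exchange_big_dep predT) //= big_seq [RHS]big_seq; apply: eq_bigr => k kr.
  have ekN : (e k < N)%N by rewrite ltnS (big_rem _ kr) leq_maxl.
  rewrite (big_pred1 (Ordinal ekN)) => [|j]; last by rewrite /= eq_sym.
  congr (_ *: _); rewrite /= /e expr_sum; apply: eq_bigr => i _.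
  by rewrite hornerXn mulnC exprM.
apply: mtensP => k; rewrite mtens_coef0; apply/eqP; rewrite mtens_coef_eq0.
apply/negP => kr; have ekN : (e k < N)%N by rewrite ltnS (big_rem _ kr) leq_maxl.
suff : mtens_coef k t = 0 by move/eqP; rewrite mtens_coef_eq0 kr.
rewrite -(w0 (Ordinal ekN)) /w big_mkcond (bigD1_seq k) ?finmap.fset_uniq //=.
rewrite eqxx big_seq_cond big1 ?addr0 // => q /andP[qr /eqP qk].
by case: eqP => // ee; case: qk; exact: e_inj.
Qed.

(** Points with coordinate sum zero are avoided because F_x has full degree n - 1 exactly when this
    sum is nonzero, and because e_21, multiplication by this sum, can then be cancelled. *)
Lemma mtens_eval_eq (t u : mtens n W) :
    (forall x, ((0 < n)%N -> \sum_(i < n) x i != 0) ->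
       mtens_eval x t = mtens_eval x u) -> t = u.
Proof.
move=> tu; apply: subr0_eq; apply: mtens_eval_inj => x x0.
by apply: (addIr (mtens_eval x u)); rewrite -mtens_evalD subrK add0r tu.
Qed.

End Density.

(** * The Gaudin Hamiltonians as differential operators *)

Section DifferentialOperators.
Context {K : fieldType} {n : nat}.
Implicit Types (m : 'I_n -> K) (s r : 'I_n) (u v : {mpoly K[n]}).

Lemma in_varM s : forall f g, in_var s (f * g) = in_var s f * in_var s g :> {mpoly K[n]}.
Proof. by move=> f g; rewrite /in_var rmorphM hornerM. Qed.

Lemma in_varX s : in_var s 'X = 'X_s :> {mpoly K[n]}.
Proof. by rewrite /in_var map_polyX hornerX. Qed.

Lemma in_varXn s j : in_var s 'X^j = 'X_[U_(s) *+ j] :> {mpoly K[n]}.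
Proof. by rewrite /in_var map_polyXn hornerXn mpolyXn. Qed.

Lemma mderiv_in_var s f : (in_var s f)^`M(s) = in_var s f^`() :> {mpoly K[n]}.
Proof.
rewrite -[f]coefK poly_def !(linear_sum, raddf_sum) /=; apply: eq_bigr => j _.
rewrite derivZ derivXn !linearZ /=; congr (_ *: _).
rewrite in_varXn mderivX raddfMn /= in_varXn mulmnE mnm1E eqxx mul1n.
case: j => [[|j] lj]; first by rewrite scale0r mulr0n.
rewrite scaler_nat; congr ('X_[_] *+ _).
by apply/mnmP => i; rewrite mnmBE !mulmnE mulnS addKn.
Qed.

Lemma mderiv_var_free s u : var_free s u -> u^`M(s) = 0.
Proof.
move=> us; rewrite [u]mpolyE raddf_sum big_seq big1 // => k /us ks.
by rewrite /= mderivZ mderivX ks scale0r scaler0.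
Qed.

(** Each monomial is a monomial free of x_s times a power of x_s, and on such products
    [factor_act_mul] computes the action on the s-th factor. *)
Lemma eq_linear_in_var s (S T : {mpoly K[n]} -> {mpoly K[n]}) :
    linear S -> linear T ->
    (forall u f, var_free s u -> S (u * in_var s f) = T (u * in_var s f)) ->
  S =1 T.
Proof.
move=> linS linT ST v.
pose S' : {linear {mpoly K[n]} -> {mpoly K[n]}} :=
  HB.pack S (GRing.isLinear.Build _ _ _ _ S linS).
pose T' : {linear {mpoly K[n]} -> {mpoly K[n]}} :=
  HB.pack T (GRing.isLinear.Build _ _ _ _ T linT).
rewrite -[S]/(S' : _ -> _) -[T]/(T' : _ -> _).
rewrite [v]mpolyE !linear_sum; apply: eq_bigr => k _.
rewrite !linearZ; congr (_ *: _).
have -> : 'X_[k] = 'X_[mnm_set k s 0] * in_var s 'X^(k s) :> {mpoly K[n]}.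
  rewrite in_varXn -mpolyXD; congr 'X_[_]; apply/mnmP => i.
  rewrite mnmDE mulmnE mnm1E mnmE eq_sym.
  by case: eqP => [->|_]; rewrite ?mul1n ?addn0.
by apply: ST => j; rewrite msuppX inE => /eqP ->; rewrite mnmE eqxx.
Qed.

Let mderiv_in_varM s u f : var_free s u ->
  (u * in_var s f)^`M(s) = u * in_var s f^`().
Proof.
by move=> us; rewrite mderivM mderiv_var_free // mul0r add0r mderiv_in_var.
Qed.

Lemma e_at11 m s v : e_at m s 0 0 v = m s *: v - 'X_s * v^`M(s).
Proof.
apply: (@eq_linear_in_var s (e_at m s 0 0)
    (fun v => m s *: v - 'X_s * v^`M(s))) v => [|a u v|u f us]; first exact: linearP.
  by rewrite mderivD mderivZ -!mul_mpolyC; ring.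
rewrite /e_at factor_act_mul // mderiv_in_varM // /verma_e /=.
by rewrite linearB linearZ /= in_varM in_varX -!mul_mpolyC; ring.
Qed.

Lemma e_at12 m s v :
  e_at m s 0 1 v = m s *: v^`M(s) - 'X_s * v^`M(s)^`M(s).
Proof.
apply: (@eq_linear_in_var s (e_at m s 0 1)
    (fun v => m s *: v^`M(s) - 'X_s * v^`M(s)^`M(s))) v => [|a u v|u f us]; first exact: linearP.
  by rewrite !(mderivD, mderivZ) -!mul_mpolyC; ring.
rewrite /e_at factor_act_mul // !mderiv_in_varM // /verma_e /=.
by rewrite linearB linearZ /= in_varM in_varX -!mul_mpolyC; ring.
Qed.

Lemma e_at21 m s v : e_at m s 1 0 v = 'X_s * v.
Proof.
apply: (@eq_linear_in_var s (e_at m s 1 0)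
    (fun v => 'X_s * v)) v => [|a u v|u f us]; first exact: linearP.
  by rewrite -!mul_mpolyC; ring.
by rewrite /e_at factor_act_mul // /verma_e /= in_varM in_varX; ring.
Qed.

Lemma e_at22 m s v : e_at m s 1 1 v = 'X_s * v^`M(s).
Proof.
apply: (@eq_linear_in_var s (e_at m s 1 1)
    (fun v => 'X_s * v^`M(s))) v => [|a u v|u f us]; first exact: linearP.
  by rewrite mderivD mderivZ -!mul_mpolyC; ring.
rewrite /e_at factor_act_mul // mderiv_in_varM // /verma_e /=.
by rewrite in_varM in_varX; ring.
Qed.

(** With d_s the derivative in x_s, this is x_s x_r (d_s - d_r)^2 + (m_r x_s - m_s x_r) (d_s - d_r),
    the differential operator of m_s m_r - Omega_{s,r} for r different from s. Unlike the latter it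
    is also wanted at r = s, where it vanishes. *)
Definition gaudin_pair m s r v : {mpoly K[n]} :=
  'X_s * 'X_r * (v^`M(s)^`M(s) - v^`M(s)^`M(r) *+ 2 + v^`M(r)^`M(r))
  + (m r *: 'X_s - m s *: 'X_r) * (v^`M(s) - v^`M(r)).

Lemma gaudin_pairC m s r v : gaudin_pair m s r v = gaudin_pair m r s v.
Proof.
by rewrite /gaudin_pair (mderiv_comm s r) -!mul_mpolyC; ring.
Qed.

Lemma gaudin_pairss m s v : gaudin_pair m s s v = 0.
Proof. by rewrite /gaudin_pair; ring. Qed.

Lemma gaudin_pairE m s r v : r != s ->
  (m s * m r) *: v - casimir m s r v = gaudin_pair m s r v.
Proof.
move=> rs; rewrite /casimir !big_ord_recl !big_ord0 /=.
have -> : lift ord0 ord0 = 1 :> 'I_2 by exact: val_inj.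
rewrite -[ord0]/(0 : 'I_2) !(e_at11, e_at12, e_at21, e_at22).
have dX i j : j != i -> ('X_j : {mpoly K[n]})^`M(i) = 0.
  by move=> ji; rewrite mderivX mnm1E (negPf ji) scale0r.
rewrite !(mderivB, mderivZ, mderivM, dX, mul0r, add0r) //.
rewrite /gaudin_pair (mderiv_comm r s) -!mul_mpolyC mpolyCM.
ring.
Qed.

Lemma gaudinE (z m : 'I_n -> K) s v : gaudin z m s v =
  \sum_(r < n | r != s) (z s - z r)^-1 *: gaudin_pair m s r v.
Proof. by apply: eq_bigr => r rs; rewrite gaudin_pairE. Qed.

End DifferentialOperators.

(** * Weighted sums of the Hamiltonians through divided differences *)

Section Symmetrization.
Context {K : fieldType} {V : lmodType K} {n : nat}.

(** Adding the copy with s and r exchanged gives [B s r] the coefficient (f_s - f_r) / (z_s - z_r) =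
    [g s r]. It is applied to the weights 1, z_s and 1 / (y - z_s), with divided differences 0, 1
    and 1 / ((y - z_s) (y - z_r)). *)
Lemma symmetrize_sum (z f : 'I_n -> K) (g : 'I_n -> 'I_n -> K)
    (B : 'I_n -> 'I_n -> V) : injective z ->
    (forall s r, B s r = B r s) -> (forall s, B s s = 0) ->
    (forall s r, f s - f r = (z s - z r) * g s r) ->
  (\sum_s f s *: \sum_(r | r != s) (z s - z r)^-1 *: B s r) *+ 2 =
  \sum_s \sum_r g s r *: B s r.
Proof.
move=> z_inj BC B0 fg.
pose T s r := (f s / (z s - z r)) *: B s r.
have -> : \sum_s f s *: \sum_(r | r != s) (z s - z r)^-1 *: B s r =
    \sum_s \sum_r T s r.
  apply: eq_bigr => s _; rewrite [RHS](bigD1 s) //= /T B0 scaler0 add0r.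
  by rewrite scaler_sumr; apply: eq_bigr => r _; rewrite scalerA.
rewrite mulr2n {2}exchange_big -big_split; apply: eq_bigr => s _ /=.
rewrite -big_split; apply: eq_bigr => r _; rewrite /= /T [B r s]BC -scalerDl.
have [->|rs] := eqVneq s r; first by rewrite B0 !scaler0.
congr (_ *: _); rewrite -(opprB (z s)) invrN mulrN -mulrBl fg.
by rewrite mulrC mulKf // subr_eq0 (inj_eq z_inj).
Qed.

End Symmetrization.

(** * Separation of variables *)

Section Curves.
Context {K : numFieldType} {n : nat}.
Implicit Types (q : 'I_n -> {poly K}) (v : {mpoly K[n]}).

Definition restrict q v : {poly K} := mmap polyC q v.

HB.instance Definition _ q := GRing.RMorphism.copy (restrict q) (mmap polyC q).

Lemma restrictX q s : restrict q 'X_s = q s.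
Proof. by rewrite /restrict mmapX mmap1U. Qed.

Lemma restrictZ q c v : restrict q (c *: v) = c *: restrict q v.
Proof. by rewrite /restrict mmapZ mul_polyC. Qed.

Lemma restrict_const (a : 'I_n -> K) v : restrict (fun s => (a s)%:P) v = (v.@[a])%:P.
Proof.
rewrite /restrict mevalE rmorph_sum; apply: eq_bigr => k _.
rewrite rmorphM rmorph_prod; congr (_ * _).
by apply: eq_bigr => i _; rewrite rmorphXn.
Qed.

Lemma horner_restrict q v y : (restrict q v).[y] = v.@[fun s => (q s).[y]].
Proof.
rewrite /restrict /mmap horner_sum mevalE; apply: eq_bigr => k _.
rewrite hornerM hornerC /mmap1 horner_prod; congr (_ * _).
by apply: eq_bigr => i _; rewrite horner_exp.
Qed.

(** The chain rule: both sides obey the Leibniz rule, so it passes from the variables to monomials,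
    and then to all polynomials by linearity. *)
Lemma deriv_restrict q v :
  (restrict q v)^`() = \sum_s restrict q v^`M(s) * (q s)^`().
Proof.
pose P v := (restrict q v)^`() = \sum_s restrict q v^`M(s) * (q s)^`().
have P1 : P 1.
  rewrite /P rmorph1 derivC big1 // => s _.
  by rewrite -mpolyC1 mderivC rmorph0 mul0r.
have PM u w : P u -> P w -> P (u * w).
  move=> Pu Pw; rewrite /P rmorphM derivM Pu Pw mulr_suml mulr_sumr -big_split.
  by apply: eq_bigr => s _; rewrite mderivM rmorphD !rmorphM /=; ring.
have PX i : P 'X_i.
  rewrite /P restrictX (bigD1 i) //= mderivX mnm1E eqxx scale1r.
  rewrite big1 => [|s si]; last by rewrite mderivX mnm1E eq_sym (negPf si) scale0r rmorph0 mul0r.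
  by rewrite -{1}[U_(i)%MM]add0m addmK mpolyX0 rmorph1 mul1r addr0.
have Pk k : P 'X_[k].
  rewrite mpolyXE_id; apply: (big_ind P) => // i _.
  by elim: (k i) => [|j IHj]; rewrite ?expr0 // exprS; apply: PM.
transitivity (\sum_(k <- msupp v) v@_k *: (restrict q 'X_[k])^`()).
  rewrite {1}[v]mpolyE (rmorph_sum (restrict q)) linear_sum; apply: eq_bigr => k _.
  by rewrite /= restrictZ derivZ.
under eq_bigr do rewrite Pk scaler_sumr.
rewrite exchange_big; apply: eq_bigr => s _.
rewrite [in RHS](mpolyE v) (linear_sum (mderiv s)) (rmorph_sum (restrict q)) mulr_suml.
apply: eq_bigr => k _.
by rewrite /= mderivZ restrictZ scalerAl.
Qed.

Lemma deriv_restrict_affine (c d : 'I_n -> K) v :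
  (restrict (fun s => (c s)%:P * 'X + (d s)%:P) v)^`() =
  \sum_s c s *: restrict (fun s => (c s)%:P * 'X + (d s)%:P) v^`M(s).
Proof.
rewrite deriv_restrict; apply: eq_bigr => s _.
by rewrite derivD derivC derivM derivC mul0r add0r derivX mulr1 addr0 mulrC mul_polyC.
Qed.

Lemma horner_deriv_restrict (c d : 'I_n -> K) v y :
  let q s := (c s)%:P * 'X + (d s)%:P in
  (restrict q v)^`().[y] = \sum_s c s * v^`M(s).@[fun s => (q s).[y]].
Proof.
rewrite /= deriv_restrict_affine horner_sum.
by apply: eq_bigr => s _; rewrite hornerZ horner_restrict.
Qed.

Lemma horner_deriv2_restrict (c d : 'I_n -> K) v y :
  let q s := (c s)%:P * 'X + (d s)%:P in
  (restrict q v)^`()^`().[y] =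
  \sum_s \sum_r c s * c r * v^`M(s)^`M(r).@[fun s => (q s).[y]].
Proof.
rewrite /= deriv_restrict_affine raddf_sum horner_sum.
apply: eq_bigr => s _; rewrite /= derivZ hornerZ horner_deriv_restrict mulr_sumr.
by apply: eq_bigr => r _; rewrite mulrA.
Qed.

Lemma sum_mul_sum (f g : 'I_n -> K) :
  \sum_s \sum_r f s * g r = (\sum_s f s) * \sum_s g s.
Proof. by rewrite mulr_suml; apply: eq_bigr => s _; rewrite mulr_sumr. Qed.

Lemma meval_gaudin_pair (m : 'I_n -> K) x s r v :
  (gaudin_pair m s r v).@[x] =
  x s * x r * (v^`M(s)^`M(s).@[x] - v^`M(s)^`M(r).@[x] *+ 2 + v^`M(r)^`M(r).@[x])
  + (m r * x s - m s * x r) * (v^`M(s).@[x] - v^`M(r).@[x]).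
Proof.
by rewrite /gaudin_pair !(mevalB, mevalD, mevalM, mevalZ, mevalXU, mevalMn).
Qed.

(** Separating the indices isolates the factor [\sum_s a s]. When it is zero, only a second and a
    first derivative in the direction [a] survive. *)
Lemma sum_pairs (a mu d : 'I_n -> K) (D : 'I_n -> 'I_n -> K) :
  \sum_s \sum_r (a s * a r * (D s s - D s r *+ 2 + D r r)
    + (mu r * a s - mu s * a r) * (d s - d r)) =
  ((\sum_s a s) * (\sum_s a s * D s s) - \sum_s \sum_r a s * a r * D s r
   + (\sum_s mu s) * (\sum_s a s * d s)
   - (\sum_s a s) * (\sum_s mu s * d s)) *+ 2.
Proof.
transitivity (\sum_s \sum_r (a s * D s s) * a r
    + \sum_s \sum_r a s * (a r * D r r)
    - (\sum_s \sum_r a s * a r * D s r) *+ 2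
    + (\sum_s \sum_r (a s * d s) * mu r + \sum_s \sum_r mu s * (a r * d r))
    - (\sum_s \sum_r a s * (mu r * d r) + \sum_s \sum_r (mu s * d s) * a r)).
  rewrite -sumrMnl -!(sumrB, big_split) /=; apply: eq_bigr => s _.
  rewrite -sumrMnl -!(sumrB, big_split) /=; apply: eq_bigr => r _; ring.
by rewrite !sum_mul_sum; ring.
Qed.

Section Gaudin.
Context (z m : 'I_n -> K) (z_inj : injective z) (x : 'I_n -> K) (v : {mpoly K[n]}).
Local Notation G s := (gaudin z m s v).@[x].
Local Notation d s := v^`M(s).@[x].
Local Notation D s r := v^`M(s)^`M(r).@[x].

Lemma weighted_gaudin_sum (f : 'I_n -> K) (g : 'I_n -> 'I_n -> K) :
    (forall s r, f s - f r = (z s - z r) * g s r) ->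
  (\sum_s f s * G s) *+ 2 =
  \sum_s \sum_r g s r * (gaudin_pair m s r v).@[x].
Proof.
move=> fg; rewrite -(@symmetrize_sum K K^o n z f g) //.
- congr (_ *+ 2); apply: eq_bigr => s _; rewrite gaudinE raddf_sum.
  congr (_ * _); apply: eq_bigr => r _; exact: mevalZ.
- by move=> s r; rewrite gaudin_pairC.
- by move=> s; rewrite gaudin_pairss meval0.
Qed.

Let half (a b : K) : a *+ 2 = b *+ 2 -> a = b.
Proof. by move/eqP; rewrite eqrMn2r // => /eqP. Qed.

Lemma gaudin_sum : \sum_s G s = 0.
Proof.
apply: half; rewrite mul0rn.
have := @weighted_gaudin_sum (fun=> 1) (fun _ _ => 0).
under eq_bigr do rewrite mul1r; move=> ->.
  by rewrite big1 // => s _; rewrite big1 // => r _; rewrite mul0r.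
by move=> s r; rewrite subrr mulr0.
Qed.

(** The weights z_s have divided difference 1. The first two terms are Euler operators, scalar on
    homogeneous polynomials, and the last one is the value of e_21 e_12. *)
Lemma gaudin_weighted_sum : \sum_s z s * G s =
  (\sum_s m s) * (\sum_s x s * d s) - \sum_s \sum_r x s * x r * D s r
  - (\sum_s x s) * (e_tot m 0 1 v).@[x].
Proof.
apply: half; rewrite (@weighted_gaudin_sum z (fun _ _ => 1)); last first.
  by move=> s r; rewrite mulr1.
under eq_bigr do under eq_bigr do rewrite mul1r meval_gaudin_pair.
rewrite (sum_pairs x m (fun s => d s) (fun s r => D s r)).
have -> : (e_tot m 0 1 v).@[x] = \sum_s m s * d s - \sum_s x s * D s s.
  rewrite raddf_sum -sumrB; apply: eq_bigr => s _.
  by rewrite /= e_at12 mevalB mevalZ mevalM mevalXU.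
by congr (_ *+ 2); ring.
Qed.

(* Sklyanin's separation of variables: [y] is one of the separated variables,
   and moving it alone moves [x] along the line [x_s = a_s (Y - z_s)]. *)
Lemma gaudin_separation (y : K) (a : 'I_n -> K) :
    (forall s, y != z s) -> (forall s, x s = a s * (y - z s)) ->
    \sum_s a s = 0 ->
  let q s := (a s)%:P * 'X + (- (a s * z s))%:P in
  \sum_s (y - z s)^-1 * G s =
  (\sum_s m s / (y - z s)) * (restrict q v)^`().[y] - (restrict q v)^`()^`().[y].
Proof.
move=> yz xa a0; pose b s := (y - z s)^-1.
have nz s : y - z s != 0 by rewrite subr_eq0.
rewrite /= horner_deriv_restrict horner_deriv2_restrict.
have qx w : w.@[fun s => ((a s)%:P * 'X + (- (a s * z s))%:P).[y]] = w.@[x].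
  by apply: meval_eq => s; rewrite xa !hornerE; ring.
under [X in _ * X]eq_bigr do rewrite qx.
under [X in _ - X]eq_bigr do under eq_bigr do rewrite qx.
apply: half; rewrite (@weighted_gaudin_sum b (fun s r => b s * b r)); last first.
  by move=> s r; rewrite /b; field; rewrite !nz.
(* Since x_s b_s = a_s, the second-order factor x_s x_r b_s b_r is a_s a_r, and m_r x_s b_s b_r is
   (m_r b_r) a_s: this is [sum_pairs] with [mu s = m s * b s]. *)
have -> : \sum_s \sum_r b s * b r * (gaudin_pair m s r v).@[x] =
    \sum_s \sum_r (a s * a r * (D s s - D s r *+ 2 + D r r)
    + (m r * b r * a s - m s * b s * a r) * (d s - d r)).
  apply: eq_bigr => s _; apply: eq_bigr => r _.
  by rewrite meval_gaudin_pair !xa /b; field; rewrite !nz.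
rewrite (sum_pairs a (fun s => m s * b s) (fun s => d s) (fun s r => D s r)).
by rewrite a0 !mul0r sub0r subr0 addrC.
Qed.

End Gaudin.
End Curves.

(** * The universal weight function along a line *)

Section MapMpoly.
Context {R S : comNzRingType} (f : {rmorphism R -> S}).

Lemma mmap_map_mpoly (T : comNzRingType) (g : {rmorphism S -> T}) l
    (h : 'I_l -> T) (w : {mpoly R[l]}) :
  mmap g h (map_mpoly f w) = mmap (g \o f) h w.
Proof.
rewrite {1}[w]mpolyE (rmorph_sum (map_mpoly f)) (rmorph_sum (mmap g h)).
apply: eq_bigr => k _.
by rewrite /= map_mpolyZ map_mpolyX mmapZ mmapX.
Qed.

Lemma map_comp_mpoly l k (w : {mpoly R[l]}) (T : l.-tuple {mpoly R[k]}) :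
  map_mpoly f (w \mPo T) =
  map_mpoly f w \mPo [tuple map_mpoly f (tnth T i) | i < l].
Proof.
rewrite [RHS]mmap_map_mpoly comp_mpolyE (rmorph_sum (map_mpoly f)).
apply: eq_bigr => j _; rewrite /= map_mpolyZ rmorph_prod /= mul_mpolyC.
by congr (_ *: _); apply: eq_bigr => i _; rewrite rmorphXn tnth_mktuple.
Qed.

Lemma map_mesym l i : map_mpoly f (mesym l R i) = mesym l S i.
Proof.
rewrite /mesym raddf_sum; apply: eq_bigr => h _.
by rewrite /= rmorph_prod; apply: eq_bigr => j _; rewrite /= map_mpolyX.
Qed.

End MapMpoly.

(* The coefficients a_1, ..., a_l of prod_j (x - t_j). *)
Definition root_coefs (A : comNzRingType) l : l.-tuple {mpoly A[l]} :=
  [tuple (-1) ^+ i.+1 *: mesym l A i.+1 | i < l].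

(** Up to the sign change [sg], an involution, this is the algebraic independence of the elementary
    symmetric polynomials. It allows identities in the a_i to be checked in the t_j, where omega is
    a product. *)
Lemma comp_root_coefs_inj (A : comNzRingType) l (u w : {mpoly A[l]}) :
  u \mPo root_coefs A l = w \mPo root_coefs A l -> u = w.
Proof.
pose sg : l.-tuple {mpoly A[l]} := [tuple (-1) ^+ i.+1 *: 'X_i | i < l].
have sgK p : (p \mPo sg) \mPo sg = p.
  rewrite Defs.comp_mpolyA -[RHS]comp_mpoly_id; congr (_ \mPo _).
  apply: eq_from_tnth => i; rewrite !tnth_mktuple comp_mpolyZ comp_mpolyXU.
  by rewrite -tnth_nth tnth_mktuple Defs.signXX.
have E p : p \mPo root_coefs A l = (p \mPo sg) \mPo [tuple mesym l A i.+1 | i < l].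
  rewrite Defs.comp_mpolyA; congr (_ \mPo _); apply: eq_from_tnth => i.
  by rewrite !tnth_mktuple comp_mpolyZ comp_mpolyXU -tnth_nth tnth_mktuple.
by rewrite !E => /msym_fundamental_un uw; rewrite -[u]sgK uw sgK.
Qed.

Section Omega.
Context {K : numFieldType} {n l : nat}.
Implicit Types (z m x a : 'I_n -> K) (q : 'I_n -> {poly K}).
Local Notation A := {poly K}.
Local Notation restr q := (map_mpoly (restrict q)).

(** The factor F_x(t_j) of omega, with x moving along the curve [q]. *)
Definition root_factor z q (j : 'I_l) : {mpoly A[l]} :=
  \sum_(s < n) q s *: \prod_(i < n | i != s) ('X_j - ((z i)%:P)%:MP).

Lemma restrict_omega_t z q :
  restr q (omega_t (l := l) z) = \prod_j root_factor z q j.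
Proof.
rewrite rmorph_prod; apply: eq_bigr => j _; rewrite /= raddf_sum.
apply: eq_bigr => s _; rewrite /= map_mpolyZ /= restrictX rmorph_prod.
congr (_ *: _); apply: eq_bigr => i _.
by rewrite rmorphB /= map_mpolyX map_mpolyC /= /restrict mmapC.
Qed.

Lemma restrict_omega_a z q :
  restr q (omega_a (l := l) z) \mPo root_coefs A l = \prod_j root_factor z q j.
Proof.
have TE : [tuple map_mpoly (restrict q) (tnth a_of_t i) | i < l] = root_coefs A l.
  apply: eq_from_tnth => i; rewrite !tnth_mktuple map_mpolyZ map_mesym.
  by rewrite rmorphXn rmorphN1.
rewrite -restrict_omega_t -omega_aP.
have := map_comp_mpoly (restrict q) (omega_a (l := l) z) a_of_t.
by rewrite TE => /esym.
Qed.

(** Each of the l factors is linear in x, so omega is homogeneous of degree l. The summand [0%:P]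
    gives the curve the affine shape of [horner_deriv_restrict]. *)
Lemma restrict_omega_homog z x :
  restr (fun s => (x s)%:P * 'X + 0%:P) (omega_a (l := l) z) =
  'X ^+ l *: restr (fun s => (x s)%:P) (omega_a z).
Proof.
apply: comp_root_coefs_inj; rewrite comp_mpolyZ !restrict_omega_a.
rewrite -mul_mpolyC rmorphXn -[in X in _ ^+ X](card_ord l) -prodr_const -big_split.
apply: eq_bigr => j _; rewrite /= mul_mpolyC scaler_sumr; apply: eq_bigr => s _.
by rewrite scalerA addr0 mulrC.
Qed.

(** This is p(Y, a), read as a polynomial in a with coefficients in K[Y]. *)
Definition gen_monic : {mpoly A[l]} :=
  (monic_of (fun i : 'I_l => 'X_i : {mpoly A[l]})).[('X)%:MP].

Lemma gen_monic_root : gen_monic \mPo root_coefs A l = \prod_j (('X)%:MP - 'X_j).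
Proof.
have E (c : 'I_l -> {mpoly A[l]}) t :
    (monic_of c).[t] = t ^+ l + \sum_i c i * t ^+ (l - i.+1).
  rewrite /monic_of hornerD hornerXn horner_sum; congr (_ + _).
  by apply: eq_bigr => i _; rewrite hornerM hornerC hornerXn.
have -> : \prod_j (('X)%:MP - 'X_j) =
    (\prod_(j < l) ('X - ('X_j)%:P)).[('X)%:MP] :> {mpoly A[l]}.
  by rewrite horner_prod; apply: eq_bigr => j _; rewrite hornerXsubC.
rewrite -(Defs.monic_roots_mpoly {poly K} l).
rewrite [RHS]E /gen_monic E (rmorphD (comp_mpoly (root_coefs A l))).
rewrite rmorphXn /= comp_mpolyC (rmorph_sum (comp_mpoly (root_coefs A l))).
congr (_ + _); apply: eq_bigr => i _.
rewrite (rmorphM (comp_mpoly (root_coefs A l))) rmorphXn /= comp_mpolyC comp_mpolyXU.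
by rewrite -tnth_nth.
Qed.

(* On the line x_s = a_s (Y - z_s) with sum_s a_s = 0, the polynomial
   F_x(t) = sum_s x_s prod_(i != s) (t - z_i) equals (Y - t) F_a(t). *)
Lemma restrict_omega_line z a : \sum_s a s = 0 ->
  restr (fun s => (a s)%:P * 'X + (- (a s * z s))%:P) (omega_a (l := l) z) =
  gen_monic * restr (fun s => (a s)%:P) (omega_a z).
Proof.
move=> a0; apply: comp_root_coefs_inj.
rewrite [LHS]restrict_omega_a.
rewrite [RHS](rmorphM (comp_mpoly (root_coefs A l))).
rewrite [X in _ = X * _]gen_monic_root [X in _ = _ * X]restrict_omega_a.
rewrite -big_split; apply: eq_bigr => j _ /=.
(* As a_s (Y - z_s) = a_s (Y - t_j) + a_s (t_j - z_s), the second part contributes a_s times the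
   full product [N]; these contributions cancel in the sum over s. *)
pose N : {mpoly A[l]} := \prod_i ('X_j - ((z i)%:P)%:MP).
have N0 : \sum_s ((a s)%:P : A) *: N = 0.
  by rewrite -scaler_suml -rmorph_sum a0 scale0r.
rewrite -[RHS]addr0 -N0 /root_factor mulr_sumr -big_split.
apply: eq_bigr => s _; rewrite [N](bigD1 s) //= -!mul_mpolyC.
rewrite polyCN polyCM mpolyCD mpolyCN !mpolyCM.
ring.
Qed.

Section Transport.
Local Notation P := {mpoly K[l + n]}.
Local Notation alpha k := (\prod_(i < l) (avar i : P) ^+ k i).

(** The line factorization, moved to polynomials in Y over K[a, h]. Here C is omega at the point a;
    what matters later is that it does not involve Y. *)
Lemma omega_line_factor z a : \sum_s a s = 0 ->
  exists C : P,
    \sum_(k <- msupp (omega_a (l := l) z))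
      map_poly (@mpolyC (l + n) K)
        (restrict (fun s => (a s)%:P * 'X + (- (a s * z s))%:P) (omega_a z)@_k)
      * (alpha k)%:P = C%:P * pgen.
Proof.
move=> a0.
pose f : {rmorphism A -> {poly P}} := map_poly (@mpolyC (l + n) K).
pose Psi := mmap f (fun i : 'I_l => (avar i)%:P).
have alphaE k : mmap1 (fun i : 'I_l => (avar i : P)%:P) k = (alpha k)%:P.
  by rewrite rmorph_prod; apply: eq_bigr => i _; rewrite rmorphXn.
have PsiE q : Psi (restr q (omega_a z)) =
    \sum_(k <- msupp (omega_a z)) f (restrict q (omega_a z)@_k) * (alpha k)%:P.
  by rewrite /Psi mmap_map_mpoly; apply: eq_bigr => k _; rewrite alphaE.
exists (\sum_(k <- msupp (omega_a z)) ((omega_a z)@_k).@[a] *: alpha k).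
rewrite -PsiE restrict_omega_line // /Psi rmorphM /= -/Psi mulrC; congr (_ * _).
  rewrite PsiE rmorph_sum; apply: eq_bigr => k _.
  rewrite -mul_mpolyC [RHS]rmorphM /=; congr (_ * _).
  by rewrite restrict_const /f /= map_polyC.
rewrite /Psi /gen_monic /pgen /monic_of hornerD hornerXn horner_sum rmorphD rmorphXn.
rewrite rmorph_sum /= mmapC /f /= map_polyX; congr (_ + _); apply: eq_bigr => i _.
rewrite hornerM hornerC hornerXn rmorphM rmorphXn /= mmapC mmapX mmap1U /=.
by rewrite map_polyX.
Qed.

End Transport.
End Omega.

(** * The ideal of A_D *)

Lemma coefM_top (R : nzRingType) (p q : {poly R}) (a b : nat) :
  (size p <= a.+1)%N -> (size q <= b.+1)%N -> (p * q)`_(a + b) = p`_a * q`_b.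
Proof.
move=> pa qb; have ab : (a < (a + b).+1)%N by rewrite ltnS leq_addr.
rewrite coefM (bigD1 (Ordinal ab)) //= addKn big1 ?addr0 // => i ia.
have [ia_lt|ai|/eqP] := ltngtP i a.
- rewrite [q`__]nth_default ?mulr0 //; apply: leq_trans qb _.
  lia.
- by rewrite [p`__]nth_default ?mul0r // (leq_trans pa).
by rewrite -[_ == _]/(i == Ordinal ab) (negPf ia).
Qed.

Section Ideal.
Context {K : fieldType} {n l : nat} (z m : 'I_n -> K).
Local Notation P := {mpoly K[l + n]}.
Local Notation gens := (ID_gens (l := l) z m).
Local Notation pi := (AD_pi (l := l) z m).
Implicit Types (c : 'I_n -> P) (p q : P) (y : K).

HB.instance Definition _ := GRing.isZmodMorphism.Build P (AD (l := l) z m) pi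
  (gen_pi_additive gens).

Lemma AD_piM p q : pi (p * q) = pi p * pi q.
Proof. exact: gen_piM. Qed.

Lemma AD_piZ (a : K) p : pi (a *: p) = a *: pi p.
Proof. exact: gen_piZ. Qed.

Lemma AD_pi_gen g : g \in gens -> pi g = 0.
Proof.
move=> gI; rewrite -[RHS](raddf0 pi); apply/gen_pi_eq; rewrite subr0.
apply/gen_idealP; have gi : (index g gens < size gens)%N.
  by rewrite index_mem.
exists (fun i => (i == Ordinal gi)%:R); rewrite (bigD1 (Ordinal gi)) //= eqxx mul1r.
rewrite nth_index // big1 ?addr0 // => i /negPf ->; exact: mul0r.
Qed.

Lemma AD_pi_qm1 : pi qm1 = 0.
Proof. by apply: AD_pi_gen; rewrite mem_head. Qed.

Lemma size_prod_lin (S : pred 'I_n) :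
  size (\prod_(r < n | S r) lin z r : {poly P}) = #|S|.+1.
Proof. by rewrite /lin -big_filter size_prod_XsubC -sum1_size big_filter sum1_card. Qed.

Lemma size_clear_den c : (size (clear_den z c) <= n)%N.
Proof.
apply: leq_trans (size_sum _ _ _) _; apply/bigmax_leqP => s _.
apply: leq_trans (size_mul_leq _ _) _.
rewrite size_prod_lin cardC1 card_ord size_polyC.
have n0 : (0 < n)%N by apply: leq_ltn_trans (ltn_ord s).
by case: (_ != _) => /=; lia.
Qed.

(** This is x / (x - z_s) = 1 + z_s / (x - z_s) with denominators cleared. *)
Lemma mulX_clear_den c : 'X * clear_den z c =
  (\sum_s c s)%:P * (\prod_r lin z r) + clear_den z (fun s => (z s)%:MP * c s).
Proof.
rewrite raddf_sum mulr_suml /clear_den mulr_sumr -big_split.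
apply: eq_bigr => s _; rewrite [\prod_r _](bigD1 s) //= polyCM {2}/lin; ring.
Qed.

Lemma coef_prod_lin : (\prod_r lin z r : {poly P})`_n = 1.
Proof.
have := monic_prod_XsubC (index_enum 'I_n) xpredT (fun r => (z r)%:MP : P).
rewrite monicE lead_coefE size_prod_lin cardT size_enum_ord /= => /eqP; exact.
Qed.

Lemma coef_mulX_clear_den c : ('X * clear_den z c)`_n = \sum_s c s.
Proof.
rewrite mulX_clear_den coefD coefCM coef_prod_lin mulr1.
by rewrite [X in _ + X]nth_default ?addr0 // size_clear_den.
Qed.

Lemma size_mulX (p : {poly P}) j : (size p <= j)%N -> (size ('X * p)%R <= j.+1)%N.
Proof. by move=> pj; apply: leq_trans (size_mul_leq _ _) _; rewrite size_polyX. Qed.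

Lemma coef_pgen : (pgen : {poly P})`_l = 1.
Proof.
rewrite /pgen /monic_of coefD coefXn eqxx coef_sum big1 ?addr0 // => i _.
rewrite coefCM coefXn gtn_eqF ?mulr0 // ltn_subrL /=.
exact: leq_ltn_trans (ltn_ord i).
Qed.

Lemma size_pgen : (size (pgen : {poly P}) <= l.+1)%N.
Proof.
apply: leq_trans (size_polyD _ _) _; rewrite size_polyXn geq_max leqnn /=.
apply: leq_trans (size_sum _ _ _) _; apply/bigmax_leqP => i _.
rewrite mul_polyC; apply: leq_trans (size_scale_leq _ _) _.
by rewrite size_polyXn ltnS leq_subr.
Qed.

Let natrMpred (B : comNzRingType) k : (k * k.-1)%:R = k%:R * (k%:R - 1) :> B.
Proof. by case: k => [|k]; rewrite ?mul0r // natrM -natr1 addrK. Qed.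

Let horner_Dh (B : comNzRingType) (a b c d e f : {poly B}) t aa cc ee :
    a.[t] = aa -> c.[t] = cc -> e.[t] = ee ->
  (a * b - c * d + e * f).[t] = aa * b.[t] - cc * d.[t] + ee * f.[t].
Proof. by move=> <- <- <-; rewrite !hornerE. Qed.

Let ring_Dh (B : comNzRingType) (X N cm ch czh p p1 p2 q : B) :
    X * ch = q * N + czh ->
  X * (X * (N * p2 - cm * p1 + ch * p)) =
  N * (X * (X * p2)) - X * cm * (X * p1) + (q * (X * N * p) + X * czh * p).
Proof.
move=> hE; have -> : q * (X * N * p) + X * czh * p = X * p * (X * ch).
  by rewrite hE; ring.
ring.
Qed.

(* The coefficients of D_h(p) are read off from ['X * ('X * D_h(p))], which
   makes the cases l = 0, 1 and n = 1 uniform. *)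
Lemma AD_pi_coef_Dh j : pi (Dh z m pgen)`_j = 0.
Proof.
(* Below degree l + n - 2 the coefficients are the generators q_i with i at least 1. *)
have [jl|jl] := ltnP j.+2 (l + n).
  apply: AD_pi_gen; rewrite !inE; apply/orP; right; apply/orP; right.
  apply/mapP; exists (l + n - 2 - j)%N; last by rewrite /qi; congr (_`__); lia.
  by rewrite mem_iota; lia.
pose p : {poly P} := pgen.
pose E1 := 'X * p^`(); pose E2 := 'X * ('X * p^`()^`()).
pose N : {poly P} := \prod_r lin z r.
pose ms s : P := (m s)%:MP.
pose zh s : P := (z s)%:MP * hvar s.
have DhE2 : 'X * ('X * Dh z m p) = N * E2 - ('X * clear_den z ms) * E1
    + (qm1%:P * ('X * N * p) + ('X * clear_den z zh) * p).
  exact/ring_Dh/mulX_clear_den.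
have -> : (Dh z m p)`_j = ('X * ('X * Dh z m p))`_j.+2.
  by rewrite !coefXM.
rewrite DhE2 !coefD coefCM !raddfD /= AD_piM AD_pi_qm1 mul0r add0r -!raddfD /=.
have coefE1 i : E1`_i = p`_i *+ i.
  by rewrite /E1 coefXM coef_deriv; case: i.
have coefE2 i : E2`_i = p`_i *+ (i * i.-1).
  rewrite /E2 coefXM; case: i => // i; rewrite coefXM !coef_deriv.
  by case: i => [|i] //=; rewrite ?muln0 // -mulrnA mulnC.
have Nn : N`_n = 1 := coef_prod_lin.
have pl : p`_l = 1 := coef_pgen.
have szN : (size N <= n.+1)%N by rewrite size_prod_lin cardT size_enum_ord.
have szp : (size p <= l.+1)%N := size_pgen.
have p0 i : (l < i)%N -> p`_i = 0 by move=> li; rewrite nth_default // (leq_trans szp).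
have szE1 : (size E1 <= l.+1)%N.
  by apply/leq_sizeP => i li; rewrite coefE1 p0 // mul0rn.
have szE2 : (size E2 <= l.+1)%N.
  by apply/leq_sizeP => i li; rewrite coefE2 p0 // mul0rn.
have szc c : (size ('X * clear_den z c)%R <= n.+1)%N by apply/size_mulX/size_clear_den.
(* With the multiple of q_{-1} gone, the coefficient in degree l + n - 2 is the product of top
   coefficients, namely q_0, and the higher ones vanish by degree. *)
have [jE|jl'] : j.+2 = (n + l)%N \/ (n + l < j.+2)%N by lia.
  have E1l : E1`_l = l%:R by rewrite coefE1 pl.
  have E2l : E2`_l = (l * l.-1)%:R by rewrite coefE2 pl.
  have T1 := etrans (coefM_top szN szE2) (congr2 *%R Nn E2l).
  have T2 := etrans (coefM_top (szc ms) szE1) (congr2 *%R (coef_mulX_clear_den ms) E1l).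
  have T3 := etrans (coefM_top (szc zh) szp) (congr2 *%R (coef_mulX_clear_den zh) pl).
  rewrite jE coefN T1 T2 T3 mul1r mulr1.
  set q := _ + _.
  have -> : q = q0 z m; last by apply: AD_pi_gen; rewrite !inE eqxx orbT.
  rewrite /q /q0 addrC; congr (_ + _).
    by apply: eq_bigr => s _; rewrite -mul_mpolyC.
  have -> : \sum_s ms s = (\sum_s m s)%:MP by rewrite rmorph_sum.
  rewrite mpolyCM mpolyCB mpolyCD mpolyC1 !mpolyC_nat.
  have -> : (l * l.-1)%:R = l%:R * (l%:R - 1) :> P.
    exact: natrMpred.
  ring.
have big0 (a b : {poly P}) : (size a <= n.+1)%N -> (size b <= l.+1)%N ->
    (a * b)`_j.+2 = 0.
  move=> an bl; rewrite nth_default //; apply: leq_trans (size_mul_leq _ _) _.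
  lia.
rewrite coefN (big0 _ _ szN szE2) (big0 _ _ (szc ms) szE1).
by rewrite (big0 _ _ (szc zh) szp) subrr addr0 raddf0.
Qed.

Lemma AD_pi_Dh (y : P) : pi (Dh z m pgen).[y] = 0.
Proof.
rewrite horner_coef raddf_sum big1 // => j _ /=.
by rewrite AD_piM AD_pi_coef_Dh mul0r.
Qed.

Lemma horner_lin r y : (lin z r : {poly P}).[y%:MP] = (y - z r)%:MP.
Proof. by rewrite /lin hornerXsubC mpolyCB. Qed.

Lemma horner_clear_den c y : (forall s, y != z s) ->
  (clear_den z c).[y%:MP] =
  (\prod_r (y - z r)) *: \sum_s (y - z s)^-1 *: c s.
Proof.
move=> yz; rewrite horner_sum scaler_sumr; apply: eq_bigr => s _.
rewrite hornerM hornerC horner_prod scalerA [\prod_r (y - z r)](bigD1 s) //=.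
rewrite mulrAC divff ?subr_eq0 // mul1r.
rewrite -mul_mpolyC mulrC rmorph_prod; congr (_ * _).
by apply: eq_bigr => r _; rewrite horner_lin.
Qed.

(** At a scalar y away from the z_s, the product of the y - z_r is an invertible scalar and can be
    divided out of D_h(p)(y). *)
Lemma AD_pi_Dh_frac y : (forall s, y != z s) ->
  let p := pgen : {poly P} in
  pi (p^`()^`().[y%:MP] - (\sum_s m s / (y - z s)) *: p^`().[y%:MP]
      + (\sum_s (y - z s)^-1 *: hvar s) * p.[y%:MP]) = 0.
Proof.
move=> yz /=; set N := \prod_r (y - z r).
have N0 : N != 0 by apply/prodf_neq0 => r _; rewrite subr_eq0.
set e := (X in pi X); suff : N *: pi e = 0.
  by move/(congr1 ( *:%R N^-1)); rewrite scalerA mulVf // scale1r scaler0.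
have hN : (\prod_r lin z r).[y%:MP] = N%:MP :> P.
  by rewrite horner_prod rmorph_prod; apply: eq_bigr => r _; rewrite horner_lin.
have hm : \sum_s (y - z s)^-1 *: (m s)%:MP = (\sum_s m s / (y - z s))%:MP :> P.
  rewrite rmorph_sum; apply: eq_bigr => s _.
  by rewrite /= -mul_mpolyC -mpolyCM mulrC.
have hc c := horner_clear_den c yz.
have := AD_pi_Dh y%:MP.
rewrite /Dh (horner_Dh _ _ _ hN (hc (fun s => (m s)%:MP)) (hc hvar)) hm -/N.
rewrite -AD_piZ /e => <-; rewrite -!mul_mpolyC; congr pi; ring.
Qed.

End Ideal.

(** * Generic separated variables *)

Section SeparatedCurve.
Context {K : numClosedFieldType} {n : nat} (z : 'I_n.+1 -> K).

Let A s : {poly K} := \prod_(i < n.+1 | i != s) ('X - (z i)%:P).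
Let interp (x : 'I_n.+1 -> K) : {poly K} := \sum_s (x s)%:P * A s.

Let size_A s : size (A s) = n.+1.
Proof.
rewrite /A -big_filter size_prod_XsubC -sum1_size big_filter.
by rewrite sum1_card cardC1 card_ord.
Qed.

Let coef_A s : (A s)`_n = 1.
Proof.
have := monic_prod_XsubC (index_enum 'I_n.+1) (predC1 s) z.
by rewrite -/(A s) monicE lead_coefE size_A => /eqP.
Qed.

Let size_interp x : (size (interp x) <= n.+1)%N.
Proof.
apply: leq_trans (size_sum _ _ _) _; apply/bigmax_leqP => s _.
by rewrite mul_polyC (leq_trans (size_scale_leq _ _)) ?size_A.
Qed.

Let interp_z x s : (interp x).[z s] = x s * (A s).[z s].
Proof.
rewrite horner_sum (bigD1 s) //= hornerM hornerC big1 ?addr0 // => r rs.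
rewrite hornerM /A (bigD1 s) 1?eq_sym //= hornerM hornerXsubC subrr.
by rewrite mul0r mulr0.
Qed.

Let linear_neq0 (a b : K) : b != 0 -> a%:P + b *: 'X != 0.
Proof.
move=> b0; apply/eqP => /(congr1 (fun p : {poly K} => p`_1)).
rewrite coefD coefC coefZ coefX coef0 add0r mulr1; exact/eqP.
Qed.

(* The roots y_k of sum_s x_s prod_(i != s) (Y - z_i) may coincide or meet the
   z_s; moving them to y_k + (k+1) c separates them for generic c. *)
Lemma separated_curve (z_inj : injective z) (x : 'I_n.+1 -> K) :
    \sum_s x s != 0 ->
  exists (X : 'I_n.+1 -> {poly K}) (B : {poly K}),
    [/\ B != 0, forall s, (X s).[0] = x s &
      forall c, B.[c] != 0 -> exists y : 'I_n -> K,
        [/\ injective y, forall k s, y k != z s &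
          forall k, \sum_s (X s).[c] / (y k - z s) = 0]].
Proof.
move=> x0; have Az s : (A s).[z s] != 0.
  rewrite horner_prod; apply/prodf_neq0 => i si.
  by rewrite hornerXsubC subr_eq0 (inj_eq z_inj) eq_sym.
(* The coefficient of degree n is the sum of the x_s, so there are exactly n roots with
   multiplicity. *)
have szF : size (interp x) = n.+1.
  apply/eqP; rewrite eqn_leq size_interp ltnNge /=; apply/negP => /leq_sizeP F0.
  move/eqP: x0; apply; rewrite -[RHS](F0 n) // coef_sum.
  by apply: eq_bigr => s _; rewrite coefCM coef_A mulr1.
have [rs Frs] := closed_field_poly_normal (interp x).
set L := lead_coef _ in Frs.
have L0 : L != 0 by rewrite lead_coef_eq0 -size_poly_eq0 szF.
have szrs : size rs = n.
  by move: szF; rewrite Frs size_scale // (size_prod_XsubC _ id) => -[].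
have FE u : (interp x).[u] = L * \prod_(k < n) (u - rs`_k).
  rewrite Frs hornerZ (big_nth 0) szrs big_mkord horner_prod; congr (_ * _).
  by apply: eq_bigr => k _; rewrite hornerXsubC.
pose Y c (k : 'I_n) := rs`_k + c * k.+1%:R.
(* Lagrange interpolation at the z_s: these are the coordinates for which F_X is L times the product
   of the u - Y_k(c). *)
pose X s := (L / (A s).[z s]) *:
  \prod_(k < n) ((z s - rs`_k)%:P + (- k.+1%:R) *: 'X).
have XE s c : (X s).[c] * (A s).[z s] = L * \prod_k (z s - Y c k).
  rewrite hornerZ mulrAC mulfVK // horner_prod; congr (_ * _).
  by apply: eq_bigr => k _; rewrite !hornerE /Y; ring.
(* [B1] vanishes where two moved roots meet, [B2] where one meets some z_s. Both are nonzero
   polynomials since the speeds k + 1 are distinct and nonzero. *)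
pose B1 := \prod_(j < n) \prod_(k < n | k != j)
  ((rs`_j - rs`_k)%:P + (j.+1%:R - k.+1%:R) *: 'X).
pose B2 := \prod_(k < n) \prod_s ((rs`_k - z s)%:P + k.+1%:R *: 'X).
exists X, (B1 * B2); split.
- rewrite mulf_neq0 //; apply/prodf_neq0 => j _; apply/prodf_neq0 => k jk.
    apply: linear_neq0; rewrite subr_eq0 eqr_nat eqSS eq_sym; exact: jk.
  by apply: linear_neq0; rewrite pnatr_eq0.
- move=> s; apply: (mulIf (Az s)); rewrite XE -interp_z FE; congr (_ * _).
  by apply: eq_bigr => k _; rewrite /Y mul0r addr0.
move=> c; rewrite hornerM mulf_eq0 negb_or => /andP[B1c B2c].
have Yz k s : Y c k != z s.
  rewrite -subr_eq0; apply: contra B2c => /eqP Ykz.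
  rewrite horner_prod (bigD1 k) //= horner_prod (bigD1 s) //=.
  have -> : ((rs`_k - z s)%:P + k.+1%:R *: 'X).[c] = Y c k - z s.
    by rewrite !hornerE /Y; ring.
  by rewrite Ykz !mul0r.
exists (Y c); split=> // [j k Yjk|k].
  apply/eqP; apply: contraNT B1c => jk.
  rewrite horner_prod (bigD1 j) //= horner_prod (bigD1 k) 1?eq_sym //=.
  have -> : ((rs`_j - rs`_k)%:P + (j.+1%:R - k.+1%:R) *: 'X).[c] = Y c j - Y c k.
    by rewrite !hornerE /Y; ring.
  by rewrite Yjk subrr !mul0r.
(* Both sides have degree at most n and agree at the n + 1 points z_s. *)
have lagrange : interp (fun s => (X s).[c]) = L *: \prod_k ('X - (Y c k)%:P).
  apply/eqP; rewrite -subr_eq0; apply/eqP.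
  apply: (@roots_geq_poly_eq0 _ _ [seq z s | s <- enum 'I_n.+1]).
  - apply/allP => _ /mapP[s _ ->]; rewrite /root !hornerE interp_z XE.
    rewrite horner_prod subr_eq0; apply/eqP; congr (_ * _).
    by apply: eq_bigr => j _; rewrite hornerXsubC.
  - by rewrite map_inj_uniq ?enum_uniq.
  rewrite size_map size_enum_ord; apply: leq_trans (size_polyD _ _) _.
  rewrite size_polyN geq_max size_interp (leq_trans (size_scale_leq _ _)) //.
  by rewrite size_prod_XsubC -sum1_size sum1_card card_ord.
apply: (mulfI (_ : \prod_i (Y c k - z i) != 0)).
  by apply/prodf_neq0 => s _; rewrite subr_eq0.
have F0 : (interp (fun s => (X s).[c])).[Y c k] = 0.
  rewrite lagrange hornerZ horner_prod (bigD1 k) //= hornerXsubC subrr.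
  by rewrite mul0r mulr0.
rewrite mulr0 -[RHS]F0 horner_sum mulr_sumr; apply: eq_bigr => s _.
rewrite hornerM hornerC mulrCA; congr (_ * _).
rewrite [\prod_i (Y c k - z i)](bigD1 s) //= mulrAC divff ?subr_eq0 // mul1r horner_prod.
by apply: eq_bigr => i _; rewrite hornerXsubC.
Qed.

End SeparatedCurve.

(** * The eigenvector property *)

Section Eigenvector.
Context {K : numClosedFieldType} {n l : nat}.
Implicit Types (z m x : 'I_n -> K) (T : {mpoly K[n]} -> {mpoly K[n]}).
Local Notation P := {mpoly K[l + n]}.

Lemma e_tot_linear m a b : linear (e_tot m a b : {mpoly K[n]} -> _).
Proof.
move=> c u v; rewrite /e_tot scaler_sumr -big_split.
by apply: eq_bigr => s _; rewrite linearP.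
Qed.

HB.instance Definition _ m a b := GRing.isLinear.Build K {mpoly K[n]}
  {mpoly K[n]} _ (e_tot m a b) (e_tot_linear m a b).

Definition a_mon (k : 'X_{1..l}) : P := \prod_(i < l) avar i ^+ k i.

(* The value at [x] of [T] applied to the universal weight function, before
   projection to [AD]. *)
Definition omega_eval z T x : P :=
  \sum_(k <- msupp (omega_a (l := l) z)) (T (omega_a z)@_k).@[x] *: a_mon k.

Lemma mtens_eval_mapl z m (T : {linear {mpoly K[n]} -> {mpoly K[n]}}) x :
  mtens_eval x (mtens_mapl T (omegaD (l := l) z m)) =
  AD_pi z m (omega_eval z T x).
Proof.
rewrite /omegaD mtens_mapl_sum mtens_eval_sum /omega_eval raddf_sum.
by apply: eq_bigr => k _; rewrite mtens_eval_pure /= AD_piZ.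
Qed.

Lemma AD_mul_linear z m (p : P) :
  linear (fun a : AD (l := l) z m => AD_pi z m p * a).
Proof.
move=> c a b; have [q ->] := gen_pi_surj a; have [r ->] := gen_pi_surj b.
rewrite -!/(AD_pi z m _) -AD_piZ -raddfD -!AD_piM -AD_piZ -raddfD /=.
by rewrite mulrDr scalerAr.
Qed.

Lemma mtens_eval_mapr z m (p : P) x :
  mtens_eval x (mtens_mapr (fun a : AD (l := l) z m => AD_pi z m p * a)
    (omegaD (l := l) z m)) = AD_pi z m (p * omega_eval z id x).
Proof.
pose g : {linear AD (l := l) z m -> AD (l := l) z m} :=
  HB.pack (fun a : AD (l := l) z m => AD_pi z m p * a)
    (GRing.isLinear.Build _ _ _ _ _ (AD_mul_linear p)).
rewrite -[X in mtens_mapr X]/(g : _ -> _).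
rewrite /omegaD mtens_mapr_sum mtens_eval_sum /omega_eval mulr_sumr raddf_sum.
apply: eq_bigr => k _; rewrite mtens_eval_pure /=.
by rewrite -AD_piM -AD_piZ -scalerAr.
Qed.

Local Notation wt z k := (mcoeff k (omega_a (l := l) z)).

Lemma restrict_wt z x k :
  restrict (fun s => (x s)%:P * 'X + 0%:P) (wt z k) = (wt z k).@[x] *: 'X^l.
Proof.
have mE q : mcoeff k (map_mpoly (restrict q) (omega_a (l := l) z)) =
    restrict q (wt z k) by exact: mcoeff_map_mpoly.
rewrite -(mE (fun s => (x s)%:P * 'X + 0%:P)) restrict_omega_homog mcoeffZ.
by rewrite (mE (fun s => (x s)%:P)) restrict_const mulrC mul_polyC.
Qed.

(** Euler's identity, from differentiating omega(Y x) = Y^l omega(x) at Y = 1; [wt_euler2]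
    differentiates twice. *)
Lemma wt_euler1 z x k :
  \sum_s x s * (wt z k)^`M(s).@[x] = l%:R * (wt z k).@[x].
Proof.
transitivity (((wt z k).@[x] *: 'X^l)^`().[1]).
  rewrite -restrict_wt horner_deriv_restrict; apply: eq_bigr => s _.
  by congr (_ * _); apply: meval_eq => r; rewrite !hornerE.
by rewrite derivZ derivXn hornerZ hornerMn hornerXn expr1n mulrC.
Qed.

Lemma wt_euler2 z x k :
  \sum_s \sum_r x s * x r * (wt z k)^`M(s)^`M(r).@[x] =
  l%:R * (l%:R - 1) * (wt z k).@[x].
Proof.
transitivity (((wt z k).@[x] *: 'X^l)^`()^`().[1]).
  rewrite -restrict_wt horner_deriv2_restrict; apply: eq_bigr => s _.
  apply: eq_bigr => r _.
  by congr (_ * _); apply: meval_eq => i; rewrite !hornerE.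
rewrite derivZ derivXn derivZ derivMn derivXn hornerZ hornerMn hornerMn hornerXn.
rewrite expr1n -mulrnA mulrC; congr (_ * _).
by case: (l) => [|j]; rewrite ?mul0r // mulnC natrM -natr1 addrK.
Qed.

(** Neither [C] nor the [w k] involve the line parameter, so the factorization can be differentiated
    in it. *)
Let deriv_factor (I : Type) (r : seq I) (f : I -> {poly K}) (w : I -> P) C
    (p : {poly P}) :
  \sum_(k <- r) map_poly (@mpolyC (l + n) K) (f k) * (w k)%:P = C%:P * p ->
  \sum_(k <- r) map_poly (@mpolyC (l + n) K) (f k)^`() * (w k)%:P = C%:P * p^`().
Proof.
move/(congr1 (@deriv _)); rewrite derivM derivC mul0r add0r => <-.
rewrite raddf_sum; apply: eq_bigr => k _.
by rewrite /= derivM derivC mulr0 addr0 deriv_map.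
Qed.

Let horner_factor (I : Type) (r : seq I) (f : I -> {poly K}) (w : I -> P) C
    (p : {poly P}) y :
  \sum_(k <- r) map_poly (@mpolyC (l + n) K) (f k) * (w k)%:P = C%:P * p ->
  \sum_(k <- r) (f k).[y] *: w k = C * p.[y%:MP].
Proof.
move/(congr1 (fun q : {poly P} => q.[y%:MP])); rewrite hornerM hornerC => <-.
rewrite horner_sum; apply: eq_bigr => k _.
by rewrite hornerM hornerC horner_map /= mul_mpolyC.
Qed.

Section Defect.
Context (z m : 'I_n -> K) (z_inj : injective z).
Local Notation pi := (AD_pi (l := l) z m).
Local Notation omega_at := (omega_eval z).

Definition defect x s : P :=
  omega_at (gaudin z m s) x - hvar s * omega_at id x.

Lemma defect_sum x : \sum_s pi (defect x s) = 0.
Proof.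
rewrite -raddf_sum sumrB -mulr_suml raddfB /= AD_piM AD_pi_qm1 mul0r subr0.
rewrite /omega_eval exchange_big big1 ?raddf0 // => k _.
by rewrite -scaler_suml gaudin_sum // scale0r.
Qed.

Lemma defect_separated x y : (forall s, y != z s) ->
  \sum_s x s / (y - z s) = 0 -> \sum_s (y - z s)^-1 *: pi (defect x s) = 0.
Proof.
move=> yz x0; pose a s := x s / (y - z s).
have xa s : x s = a s * (y - z s) by rewrite /a divfK // subr_eq0.
pose q s := (a s)%:P * 'X + (- (a s * z s))%:P.
have qy v : (restrict q v).[y] = v.@[x].
  by rewrite horner_restrict; apply: meval_eq => s; rewrite /q xa !hornerE; ring.
have [C pC] := omega_line_factor (l := l) z x0.
have H0 := horner_factor y pC.
have H1 := horner_factor y (deriv_factor pC).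
have H2 := horner_factor y (deriv_factor (deriv_factor pC)).
under eq_bigr do rewrite -AD_piZ.
rewrite -raddf_sum /=.
pose M := \sum_s m s / (y - z s).
pose p : {poly P} := pgen.
(* On the line omega is C p(Y), so its derivatives at y are C p'(y) and C p''(y); separation turns
   the sum into -C times the equation of [AD_pi_Dh_frac]. *)
have -> : \sum_s (y - z s)^-1 *: defect x s =
    - (C * (p^`()^`().[y%:MP] - M *: p^`().[y%:MP]
      + (\sum_s (y - z s)^-1 *: hvar s) * p.[y%:MP])).
  under eq_bigr do rewrite scalerBr.
  rewrite sumrB.
  have -> : \sum_s (y - z s)^-1 *: (hvar s * omega_at id x) =
      (\sum_s (y - z s)^-1 *: hvar s) * (C * p.[y%:MP]).
    rewrite mulr_suml; apply: eq_bigr => s _; rewrite -scalerAl -H0.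
    by congr (_ *: (_ * _)); apply: eq_bigr => k _; rewrite qy.
  have -> : \sum_s (y - z s)^-1 *: omega_at (gaudin z m s) x =
      M *: (C * p^`().[y%:MP]) - C * p^`()^`().[y%:MP].
    rewrite -H1 -H2 scaler_sumr -sumrB.
    under eq_bigr do rewrite scaler_sumr.
    rewrite exchange_big; apply: eq_bigr => k _.
    rewrite scalerA -scalerBl -(gaudin_separation m z_inj _ yz xa x0) scaler_suml.
    by apply: eq_bigr => s _; rewrite scalerA.
  rewrite -!mul_mpolyC; ring.
by rewrite raddfN /= AD_piM AD_pi_Dh_frac // mulr0 oppr0.
Qed.

End Defect.

End Eigenvector.

(** * Vanishing of the defects, and singularity of the weight function *)

Section MainProof.
Context {K : numClosedFieldType} (l : nat).

Lemma AD_pi_defect n (z m : 'I_n -> K) (z_inj : injective z) x s :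
  \sum_i x i != 0 -> AD_pi (l := l) z m (defect z m x s) = 0.
Proof.
case: n z m z_inj x s => [|n] z m z_inj x s x0; first by case: s.
(* Writing the defect as the value of a fixed tensor makes it polynomial along the separating curve,
   so it only has to vanish at generic c. There the n separated equations and [defect_sum] determine
   all n + 1 defects. *)
pose t := mtens_mapl (gaudin z m s) (omegaD (l := l) z m) -
  mtens_mapr (fun a : AD (l := l) z m => AD_pi z m (hvar s) * a) (omegaD z m).
have tE x' : mtens_eval x' t = AD_pi (l := l) z m (defect z m x' s).
  rewrite /defect raddfB /= -mtens_eval_mapl -mtens_eval_mapr.
  by apply/eqP; rewrite eq_sym subr_eq -mtens_evalD subrK.
have [X [B [B0 X0 XB]]] := separated_curve z_inj x0.
rewrite -tE -(eq_mtens_eval t X0).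
apply: (mtens_eval_curve_eq0 B0) => c /XB[y [y_inj yz yX]]; rewrite tE.
move: s {t tE}.
apply: (partial_fractions_eq0 (g := fun s => AD_pi z m (defect z m _ s)) z_inj y_inj yz).
  exact: defect_sum.
by move=> k; apply: defect_separated.
Qed.

Lemma gaudin_omegaD n (z m : 'I_n -> K) (z_inj : injective z) s :
  mtens_mapl (gaudin z m s) (omegaD (l := l) z m) =
  mtens_mapr (fun x : AD (l := l) z m => AD_pi z m (hvar s) * x)
    (omegaD (l := l) z m).
Proof.
have n0 : (0 < n)%N by apply: leq_ltn_trans (ltn_ord s).
apply: mtens_eval_eq => x /(_ n0) /(AD_pi_defect m z_inj s).
rewrite /defect raddfB /= -mtens_eval_mapl -mtens_eval_mapr.
by move/eqP; rewrite subr_eq0 => /eqP.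
Qed.

(* e_21 acts as multiplication by sum_s x_s, so it suffices that e_21 e_12 kills
   omega at the points where this sum is nonzero. *)
Lemma e12_omegaD n (z m : 'I_n -> K) (z_inj : injective z) :
  mtens_mapl (e_tot m 0 1) (omegaD (l := l) z m) = 0.
Proof.
apply: mtens_eval_eq => x x0; rewrite mtens_eval0 mtens_eval_mapl.
have [n0|n0] := posnP n.
  rewrite /omega_eval big1 ?raddf0 // => k _.
  rewrite /= /e_tot big1 ?meval0 ?scale0r // => s _.
  by have := leq_ltn_trans (leq0n _) (ltn_ord s); rewrite [X in (_ < X)%N]n0.
have {}x0 := x0 n0; set E := omega_eval z _ x.
apply/eqP; have /eqP : (\sum_s x s) *: AD_pi z m E = 0; last first.
  by rewrite scaler_eq0 (negPf x0).
pose O := omega_eval (l := l) z id x.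
pose c : K := l%:R * (\sum_(s < n) m s + 1 - l%:R).
(* By Euler's identities the scalar part is c, the same constant as in q_0. Hence the z-weighted sum
   of defects is, up to a multiple of q_0, the value of -e_21 e_12. *)
have GE : \sum_s z s *: omega_eval z (gaudin z m s) x =
    c *: O - (\sum_s x s) *: E.
  under eq_bigr do rewrite scaler_sumr.
  rewrite exchange_big /O /E !scaler_sumr -sumrB; apply: eq_bigr => k _.
  under eq_bigr do rewrite scalerA.
  rewrite -scaler_suml gaudin_weighted_sum // wt_euler1 wt_euler2.
  by rewrite !scalerA -scalerBl /c; congr (_ *: _); ring.
rewrite -AD_piZ (_ : (\sum_s x s) *: E =
    - (q0 z m * O + \sum_s z s *: defect z m x s)); last first.
  have -> : \sum_s z s *: defect z m x s =
      c *: O - (\sum_s x s) *: E - (\sum_s z s *: hvar s) * O.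
    rewrite -GE mulr_suml -sumrB; apply: eq_bigr => s _.
    by rewrite scalerBr scalerAl.
  by rewrite /q0 -/c -!mul_mpolyC; ring.
rewrite raddfN raddfD /= AD_piM (_ : AD_pi z m (q0 z m) = 0); last first.
  by apply: AD_pi_gen; rewrite !inE eqxx orbT.
rewrite mul0r add0r raddf_sum big1 ?oppr0 // => s _.
by rewrite /= AD_piZ AD_pi_defect // scaler0.
Qed.

(** The weight condition of [Sing] as the kernel of a linear map, the form needed by
    [in_mtens_ker2]. *)
Definition e22_shift n (m : 'I_n -> K) (v : {mpoly K[n]}) :=
  e_tot m 1 1 v - l%:R *: v.

Lemma e22_shift_linear n (m : 'I_n -> K) : linear (e22_shift m).
Proof.
move=> c u v; rewrite /e22_shift e_tot_linear -!mul_mpolyC.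
ring.
Qed.

HB.instance Definition _ n (m : 'I_n -> K) := GRing.isLinear.Build K {mpoly K[n]}
  {mpoly K[n]} _ (e22_shift m) (e22_shift_linear m).

Lemma e22_omegaD n (z m : 'I_n -> K) :
  mtens_mapl (e22_shift m) (omegaD (l := l) z m) = 0.
Proof.
apply: mtens_eval_eq => x _; rewrite mtens_eval0 mtens_eval_mapl.
rewrite /omega_eval big1 ?raddf0 // => k _.
rewrite /e22_shift mevalB mevalZ -wt_euler1 /e_tot raddf_sum.
rewrite (eq_bigr (fun s => x s * (mcoeff k (omega_a z))^`M(s).@[x])).
  by rewrite subrr scale0r.
by move=> s _; rewrite /= e_at22 mevalM mevalXU.
Qed.

(** The extensions of e_12 and of e_22 - l both kill the tensor; [in_mtens_ker2] converts this into
    an expression whose first factors are themselves singular. *)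
Lemma omegaD_sing n (z m : 'I_n -> K) (z_inj : injective z) :
  in_mtens (Sing m l) (omegaD (l := l) z m).
Proof.
have [N [v [w DE]]] : exists N (v : 'I_N -> {mpoly K[n]}) (w : 'I_N -> AD (l := l) z m),
    omegaD (l := l) z m = \sum_(i < N) mtens_pure (v i) (w i).
  by rewrite /omegaD big_tnth; do 3!eexists; reflexivity.
have := e12_omegaD m z_inj; have := e22_omegaD z m.
rewrite DE !mtens_mapl_sum => T0 S0.
have [N' [v' [w' [vw ->]]]] := in_mtens_ker2 S0 T0.
exists N', v', w'; split=> // i; have [? /eqP] := vw i.
by rewrite subr_eq0 => /eqP.
Qed.

End MainProof.

Theorem theorem3p4p2 (R : realType) (n l : nat) (z m : 'I_n -> R[i])
    (z_inj : injective z) :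
  (forall s : 'I_n,
     mtens_mapl (gaudin z m s) (omegaD (l := l) z m) =
     mtens_mapr (fun x : AD (l := l) z m => AD_pi z m (hvar s) * x)
       (omegaD (l := l) z m)) /\
  in_mtens (Sing m l) (omegaD (l := l) z m).
Proof. by split; [exact: gaudin_omegaD | exact: omegaD_sing]. Qed.
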